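(* Let $(\Omega,\sigma)$ be an irreducible sofic shift over a finite alphabet. Let $\varphi=(\varphi_1,\ldots,\varphi_d)\in C(\Omega,\mathbb{Q}^d)$ be a $\mathbb{Q}^d$-valued locally constant function and let $h\in \operatorname{int}(\mathrm{Rot}(\varphi))\cap\mathbb{Q}^d$. Then there is a residual (dense $G_\delta$) subset $R\subset C(\Omega,\mathbb R)$ such that for every $f\in R$, every $\mu\in\mathcal M^\varphi_h(f)$ has zero measure-theoretic entropy $h_\mu(\sigma)=0$.
   Context: Let $\mathcal A$ be a finite set, $\mathbb N_0=\{0,1,2,\dots\}$, and $\mathcal A^{\mathbb N_0}$ carry the product of discrete topologies; $\sigma$ is the left shift. A subshift is a closed $\sigma$-invariant $\Omega\subset\mathcal A^{\mathbb N_0}$, with language $\mathcal L(\Omega)$ the set of finite words $u$ whose cylinder $[u]=\{\underline x\in\Omega: x_0\cdots x_{|u|-1}=u\}$ is nonempty. $\Omega$ is irreducible if for all symbols $i,j$ there is $u\in\mathcal L(\Omega)$ with $iuj\in\mathcal L(\Omega)$. The follower set of $u$ is $F_\Omega(u)=\{v\in\mathcal L(\Omega):uv\in\mathcal L(\Omega)\}$; $\Omega$ is sofic if there are only finitely many distinct follower sets. $\varphi$ is locally constant if each $\varphi_i(x)$ depends only on $x_0,\dots,x_{k_i}$ for some $k_i\ge0$. $C(\Omega,\mathbb R)$ has the sup norm. $\mathcal M_\sigma(\Omega)$ is the set of $\sigma$-invariant Borel probability measures (weak* topology). $\mathrm{rv}_\varphi(\mu)=(\int\varphi_1d\mu,\dots,\int\varphi_dd\mu)$,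 $\mathrm{Rot}(\varphi)=\{\mathrm{rv}_\varphi(\mu):\mu\in\mathcal M_\sigma(\Omega)\}$. For $h\in\mathrm{Rot}(\varphi)$ and $f\in C(\Omega,\mathbb R)$: $\beta^\varphi_h(f)=\sup_{\mu\in\mathrm{rv}_\varphi^{-1}(h)}\int f\,d\mu$ and $\mathcal M^\varphi_h(f)=\{\mu\in\mathcal M_\sigma(\Omega):\mathrm{rv}_\varphi(\mu)=h,\ \int f\,d\mu=\beta^\varphi_h(f)\}$ (relative maximizing measures of $f$ with constraint $h$). *)

(* Defs.v *)
From HB Require Import structures.
From mathcomp Require Import all_boot all_order all_algebra.
From mathcomp Require Import all_classical all_reals all_analysis.
Set Implicit Arguments. Unset Strict Implicit. Unset Printing Implicit Defensive.
Import Order.TTheory GRing.Theory Num.Theory.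
Import numFieldNormedType.Exports.
Local Open Scope classical_set_scope.
Local Open Scope ring_scope.

Section Shift.
Variable A : finType.

Definition seqsp := nat -> A.

Definition shift (x : seqsp) : seqsp := fun n => x n.+1.

Definition cyl (x : seqsp) (n : nat) : set seqsp :=
  [set y | forall j, (j < n)%N -> y j = x j].

(** open sets of the product of discrete topologies
    (the cylinders form a base) *)
Definition prod_open (U : set seqsp) : Prop :=
  forall x, U x -> exists n, cyl x n `<=` U.

Definition prod_closed (S : set seqsp) : Prop := prod_open (~` S).

Definition subshift (Om : set seqsp) : Prop :=
  prod_closed Om /\ shift @` Om `<=` Om.

Definition language (Om : set seqsp) : set (seq A) :=
  [set u | exists2 x, Om x & forall j, (j < size u)%N -> x j = nth (x j) u j].

Definition follower (Om : set seqsp) (u : seq A) : set (seq A) :=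
  [set v | language Om v /\ language Om (u ++ v)].

Definition irreducible (Om : set seqsp) : Prop :=
  forall i j : A, exists u : seq A, language Om (i :: u ++ [:: j]).

Definition sofic (Om : set seqsp) : Prop :=
  finite_set [set F | exists u : seq A, F = follower Om u].

End Shift.

(** A^{N_0} as a pointed type (pointedness, needed by the measure library,
    is obtained from a fixed symbol a0; it plays no mathematical role). *)
Definition pseq (A : finType) (a0 : A) : Type := nat -> A.
HB.instance Definition _ (A : finType) (a0 : A) := Choice.copy (pseq a0) (nat -> A).
HB.instance Definition _ (A : finType) (a0 : A) := isPointed.Build (pseq a0) (fun _ => a0).

Definition borel_open (A : finType) (a0 : A) : set (set (pseq a0)) := @prod_open A.

Section Functions.
Variables (A : finType) (a0 : A) (R : realType).
Local Notation X := (g_sigma_algebraType (@borel_open A a0)).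

Definition cont_on (Om : set (seqsp A)) (f : seqsp A -> R) : Prop :=
  forall x, Om x -> forall e : R, 0 < e -> exists n,
    forall y, Om y -> cyl x n y -> `|f x - f y| < e.

Definition loc_const (Om : set (seqsp A)) (T : Type) (phi : seqsp A -> T) : Prop :=
  exists k : nat, forall x y, Om x -> Om y -> cyl x k.+1 y -> phi x = phi y.

Definition supdist (Om : set (seqsp A)) (f g : seqsp A -> R) : R :=
  sup [set `|f x - g x| | x in Om].

Definition C_open (Om : set (seqsp A)) (U : set (seqsp A -> R)) : Prop :=
  U `<=` cont_on Om /\
  forall f, U f -> exists2 e : R, 0 < e &
    forall g, cont_on Om g -> supdist Om f g < e -> U g.

Definition C_dense (Om : set (seqsp A)) (S : set (seqsp A -> R)) : Prop :=
  S `<=` cont_on Om /\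
  forall f, cont_on Om f -> forall e : R, 0 < e ->
    exists2 g, S g & supdist Om f g < e.

Definition C_Gdelta (Om : set (seqsp A)) (S : set (seqsp A -> R)) : Prop :=
  exists U : nat -> set (seqsp A -> R),
    (forall n, C_open Om (U n)) /\ S = \bigcap_n U n.

Definition C_residual (Om : set (seqsp A)) (S : set (seqsp A -> R)) : Prop :=
  C_Gdelta Om S /\ C_dense Om S.

Definition inv_meas (Om : set (seqsp A)) (mu : probability X R) : Prop :=
  mu Om = 1%E /\
  forall B : set X, measurable B -> mu (@shift A @^-1` B) = mu B.

Definition integ (Om : set (seqsp A)) (mu : probability X R) (f : seqsp A -> R) : R :=
  fine (\int[mu]_(x in (Om : set X)) (f x)%:E).

Definition rv (Om : set (seqsp A)) (d : nat) (phi : 'I_d -> seqsp A -> rat)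
  (mu : probability X R) : 'rV[R]_d :=
  \row_i integ Om mu (fun x => ratr (phi i x)).

Definition Rot (Om : set (seqsp A)) (d : nat) (phi : 'I_d -> seqsp A -> rat) : set 'rV[R]_d :=
  [set v | exists mu, inv_meas Om mu /\ rv Om phi mu = v].

Definition beta (Om : set (seqsp A)) (d : nat) (phi : 'I_d -> seqsp A -> rat)
  (h : 'rV[R]_d) (f : seqsp A -> R) : R :=
  sup [set integ Om mu f | mu in [set mu | inv_meas Om mu /\ rv Om phi mu = h]].

Definition rel_max (Om : set (seqsp A)) (d : nat) (phi : 'I_d -> seqsp A -> rat)
  (h : 'rV[R]_d) (f : seqsp A -> R) : set (probability X R) :=
  [set mu | inv_meas Om mu /\ rv Om phi mu = h /\ integ Om mu f = beta Om phi h f].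

Definition meas_partition (xi : seq (set X)) : Prop :=
  (forall i, (i < size xi)%N -> measurable (nth set0 xi i)) /\
  (forall i j, (i < size xi)%N -> (j < size xi)%N -> i <> j ->
     nth set0 xi i `&` nth set0 xi j = set0) /\
  \bigcup_(i in [set i | (i < size xi)%N]) nth set0 xi i = setT.

Definition eta (t : R) : R := - (t * ln t).

Definition join_entropy (mu : probability X R) (xi : seq (set X)) (n : nat) : R :=
  \sum_(w : {ffun 'I_n -> 'I_(size xi)})
     eta (fine (mu [set x | forall i : 'I_n, nth set0 xi (w i) (iter i (@shift A) x)])).

Definition part_entropy (mu : probability X R) (xi : seq (set X)) : R :=
  limn (fun n => join_entropy mu xi n.+1 / n.+1%:R).

Definition ks_entropy (mu : probability X R) : \bar R :=
  ereal_sup [set (part_entropy mu xi)%:E | xi in meas_partition].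

End Functions.

(* Main.v *)
Require Import Defs.
From HB Require Import structures.
From mathcomp Require Import all_boot all_order all_algebra.
From mathcomp Require Import all_classical all_reals all_analysis.
From mathcomp Require Import ring lra zify.
Set Implicit Arguments. Unset Strict Implicit. Unset Printing Implicit Defensive.
Import Order.TTheory GRing.Theory Num.Theory.
Import numFieldNormedType.Exports.
Local Open Scope classical_set_scope.
Local Open Scope ring_scope.

(** Fix k. In a sofic shift, cutting a sequence wherever the pair (follower set of
    the past, window of length k) repeats exhibits its Birkhoff sums of functions
    of k coordinates as sums over periodic orbits of bounded period, up to a
    bounded remainder. Integrating and passing to the limit, every invariant
    measure has a periodic replica: an invariant measure with the same k-marginals
    carried by a finite set P_k of periodic points. If phi depends on k
    coordinates, the replica satisfies the same constraint.

    Given f, replace it by a nearby function f_k of k coordinates and subtract a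
    small penalty c off the set of points whose first N letters are those of a
    point of P_k. A relative maximizing measure of any function r-close to the
    result must do at least as well as its own replica, which pays no penalty, so
    it gives the penalized set mass at most 2 r / c. Hence the functions all of
    whose relative maximizing measures are, at some scale N, almost carried by
    exp(o(N)) words of length N form a residual set, and a measure with this
    property has zero entropy: by Gibbs' inequality, the entropy of any partition
    is bounded by the length of a code which spells the sequence by blocks of
    length N and corrects the names of points that a clopen approximation of the
    partition gets wrong. *)

(** * Cylinders, continuous functions, Baire's theorem *)

Section Topology.
Variables (A : finType).
Implicit Types (Om : set (seqsp A)) (x y z : seqsp A).

Lemma cyl_sym x y n : cyl x n y -> cyl y n x.
Proof. by move=> xy j /xy. Qed.

Lemma cyl_trans y x z n : cyl x n y -> cyl y n z -> cyl x n z.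
Proof. by move=> xy yz j jn; rewrite yz // xy. Qed.

Lemma cyl_le n m x y : (n <= m)%N -> cyl x m y -> cyl x n y.
Proof. by move=> nm xy j jn; apply: xy; exact: leq_trans nm. Qed.

Lemma prod_closed_mem Om x : prod_closed Om ->
  (forall n, exists2 y, Om y & cyl x n y) -> Om x.
Proof.
move=> cOm Hx; apply: contrapT => /cOm[n sub].
by have [y Oy /sub] := Hx n.
Qed.

(* Koenig's lemma: a cylinder over which no uniform [N] works can be refined
   letter by letter, and the limit sequence contradicts the local hypothesis. *)
Lemma cyl_compact Om (G : seqsp A -> nat -> Prop) : prod_closed Om ->
  (forall x y n m, G x n -> cyl x n y -> (n <= m)%N -> G y m) ->
  (forall x, Om x -> exists n, G x n) ->
  exists N, forall x, Om x -> G x N.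
Proof.
move=> cOm mono loc; apply: contrapT => noN.
have bad0 N : exists2 y, Om y & ~ G y N.
  apply: contrapT => H; apply: noN; exists N => x Ox.
  by apply: contrapT => nG; apply: H; exists x.
pose bad x n := forall N, exists2 y, Om y & cyl x n y /\ ~ G y N.
pose upd x n (a : A) : seqsp A := fun j => if j == n then a else x j.
have step x n : exists a, bad x n -> bad (upd x n a) n.+1.
  apply: contrapT => /forallNP H.
  have {}H a : bad x n /\ exists N, forall y, Om y -> cyl (upd x n a) n.+1 y -> G y N.
    have /not_implyP[bx nb] := H a; split => //.
    move/existsNP: nb => [N nb]; exists N => y Oy cy.
    by apply: contrapT => nG; apply: nb; exists y.
  have [x0 _ _] := bad0 0%N.
  have bx : bad x n by have [] := H (x0 0%N).
  have /choice[F HF] a : exists N, forall y, Om y -> cyl (upd x n a) n.+1 y -> G y N.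
    by have [] := H a.
  have [y Oy [cy]] := bx (\max_a F a)%N; apply.
  (* The largest of the bounds found over the one-letter refinements serves the whole cylinder: [y]
     lies in the refinement by its own letter [y n]. *)
  apply: (mono y y (F (y n))) => //; last exact: leq_bigmax.
  apply: HF => // j; rewrite ltnS leq_eqVlt /upd.
  by case: eqP => [->//|_ /= jn]; exact: cy.
have [x0 _ _] := bad0 0%N.
have /choice[pk Hpk] : forall p : seqsp A * nat,
    exists a, bad p.1 p.2 -> bad (upd p.1 p.2 a) p.2.+1.
  by case=> x n; exact: step.
pose X := fix X n := if n is m.+1 then upd (X m) m (pk (X m, m)) else x0.
have badX n : bad (X n) n.
  elim: n => [N|n IH] /=; last exact: (Hpk (X n, n)).
  by have [y Oy nG] := bad0 N; exists y.
have Xst n m j : (j < n)%N -> (n <= m)%N -> X m j = X n j.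
  move=> jn; elim: m => [|m IH]; first by rewrite leqn0 => /eqP->.
  rewrite leq_eqVlt => /orP[/eqP->//|nm].
  rewrite /= /upd ifN; first exact: IH.
  by rewrite neq_ltn (leq_trans jn).
pose x : seqsp A := fun n => X n.+1 n.
have Xx n : cyl (X n) n x.
  by move=> j jn; rewrite /x (Xst j.+1 n j).
have badx n : bad x n.
  move=> N; have [y Oy [cy nG]] := badX n N.
  by exists y => //; split=> //; exact: cyl_trans (cyl_sym (Xx n)) cy.
have Ox : Om x.
  by apply: prod_closed_mem => // n; have [y Oy [cy _]] := badx n 0%N; exists y.
have [n Gn] := loc x Ox.
by have [y Oy [cy]] := badx n n; apply; exact: mono Gn cy _.
Qed.

Variable R : realType.
Implicit Types (f g : seqsp A -> R).

Lemma cont_on_bounded Om f : prod_closed Om -> cont_on Om f ->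
  exists N : nat, forall x, Om x -> `|f x| <= N%:R.
Proof.
move=> cOm cf.
have [||N HN] := @cyl_compact Om
  (fun x n => forall y, Om y -> cyl x n y -> `|f y| <= n%:R) cOm.
- move=> x y n m H xy nm z Oz yz; apply: le_trans (H z Oz _) _.
    by apply: cyl_trans xy _; exact: cyl_le yz.
  by rewrite ler_nat.
- move=> x Ox; have [n Hn] := cf x Ox 1 ltr01.
  (* The predicate given to [cyl_compact] has a single index, so one number serves both as cylinder
     length and as bound. *)
  exists (maxn n (Num.truncn (`|f x| + 1)).+1) => y Oy xy.
  have {}Hn := Hn y Oy (cyl_le (leq_maxl _ _) xy).
  have : `|f x| + 1 < (Num.truncn (`|f x| + 1)).+1%:R by exact: truncnS_gt.
  have : (Num.truncn (`|f x| + 1)).+1%:R <= (maxn n (Num.truncn (`|f x| + 1)).+1)%:R :> R.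
    by rewrite ler_nat leq_maxr.
  have : `|f y| <= `|f x| + `|f x - f y| by rewrite -{1}(subKr (f x) (f y)) ler_normB.
  by lra.
by exists N => x Ox; exact: (HN x Ox x Ox).
Qed.

Lemma cont_on_unif Om f : prod_closed Om -> cont_on Om f ->
  forall e : R, 0 < e -> exists n, forall x y, Om x -> Om y -> cyl x n y ->
  `|f x - f y| < e.
Proof.
move=> cOm cf e e0.
have [||N HN] := @cyl_compact Om
  (fun x n => forall y z, Om y -> Om z -> cyl x n y -> cyl x n z ->
  `|f y - f z| < e) cOm.
- move=> x y n m H xy nm z t Oz Ot yz yt.
  by apply: H => //; apply: cyl_trans xy _; apply: cyl_le nm _.
- move=> x Ox; have [n Hn] := cf x Ox (e / 2) (divr_gt0 e0 (ltr0Sn R 1)).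
  exists n => y z Oy Oz /(Hn y Oy) Hy /(Hn z Oz) Hz.
  have : `|f y - f z| <= `|f x - f y| + `|f x - f z|.
    by rewrite (distrC (f x) (f y)); exact: ler_distD.
  by lra.
by exists N => x y Ox Oy xy; exact: (HN x).
Qed.

(** Compactness bounds the differences, so their [sup] is a genuine least upper bound. *)
Lemma supdist_ub Om f g : prod_closed Om -> cont_on Om f -> cont_on Om g ->
  forall x, Om x -> `|f x - g x| <= supdist Om f g.
Proof.
move=> cOm /(cont_on_bounded cOm)[M HM] /(cont_on_bounded cOm)[N HN] x Ox.
apply: sup_upper_bound; last by exists x.
split; first by exists `|f x - g x|, x.
exists (M%:R + N%:R) => _ [y Oy <-].
by apply: le_trans (ler_normB _ _) _; apply: lerD; [exact: HM|exact: HN].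
Qed.

(** Over an empty [Om] the supremum takes its default value 0, hence the sign condition on [e]. *)
Lemma supdist_le Om f g (e : R) : 0 <= e ->
  (forall x, Om x -> `|f x - g x| <= e) -> supdist Om f g <= e.
Proof.
move=> e0 H; rewrite /supdist.
have [[x Ox]|/set0P/negP/negPn/eqP ->] := pselect (Om !=set0).
  apply: ge_sup; first by exists `|f x - g x|, x.
  by move=> _ [y Oy <-]; exact: H.
by rewrite image_set0 sup0.
Qed.

Lemma supdist_triangle Om f g h : prod_closed Om ->
  cont_on Om f -> cont_on Om g -> cont_on Om h ->
  supdist Om f h <= supdist Om f g + supdist Om g h.
Proof.
move=> cOm cf cg ch; apply: supdist_le.
  have [[x Ox]|/set0P/negP/negPn/eqP ->] := pselect (Om !=set0); last first.
    by rewrite /supdist !image_set0 !sup0 addr0.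
  by apply: addr_ge0; apply: le_trans (supdist_ub _ _ _ Ox).
move=> x Ox; apply: le_trans (ler_distD (g x) _ _) _.
by apply: lerD; exact: supdist_ub.
Qed.

(** Baire's argument with a sequence of balls whose radii shrink at least fourfold at each step and
    also tend to 0 like 1/n. The limit is built pointwise. *)
Lemma C_dense_bigcap Om (U : nat -> set (seqsp A -> R)) : prod_closed Om ->
  (forall n, C_open Om (U n)) -> (forall n, C_dense Om (U n)) ->
  C_dense Om (\bigcap_n U n).
Proof.
move=> cOm oU dU; split=> [f Uf|f0 cf0 e0 e0_gt0].
  by have [sub _] := oU 0%N; exact/sub/Uf.
pose ok (p : (seqsp A -> R) * R) := cont_on Om p.1 /\ 0 < p.2.
have step (np : nat * ((seqsp A -> R) * R)) : exists p', ok np.2 ->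
    [/\ ok p', p'.2 <= np.2.2 / 4, p'.2 <= np.1.+1%:R^-1,
        supdist Om np.2.1 p'.1 < np.2.2 / 4 &
        forall h, cont_on Om h -> supdist Om p'.1 h < p'.2 -> U np.1 h].
  case: np => n [g r] /=; have [[cg r0]|nok] := pselect (ok (g, r)); last by exists (g, r).
  have [sub dn] := dU n.
  have [|g' Ug' gg'] := dn g cg (r / 4); first by rewrite divr_gt0.
  have [_ /(_ g' Ug')[e e0' He]] := oU n.
  exists (g', Num.min e (Num.min (r / 4) n.+1%:R^-1)) => _.
  split=> //=; last first.
  - by move=> h ch; rewrite lt_min => /andP[ge _]; exact: He.
  - by rewrite !ge_min lexx !orbT.
  - by rewrite !ge_min lexx !orbT.
  - split=> /=; first exact: sub.
    by rewrite !lt_min e0' divr_gt0 //= invr_gt0 ltr0Sn.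
have [nx Hnx] := choice step.
pose s := fix s n := if n is m.+1 then nx (m, s m) else (f0, e0).
have oks n : ok (s n).
  elim: n => [|n IH] /=; first by split.
  by have [] := Hnx (n, s n) IH.
have Hs n := Hnx (n, s n) (oks n).
(* Intervals of half-width r/2 around the centres are nested: the centre moves by less than r/4 and
   the next half-width is at most r/8. The supremum of the lower ends lies in all of them. *)
pose a n x := (s n).1 x - (s n).2 / 2.
pose b n x := (s n).1 x + (s n).2 / 2.
have Hab n x : Om x -> a n x <= a n.+1 x /\ b n.+1 x <= b n x.
  move=> Ox; have [_ r4 _ dn _] := Hs n.
  have := supdist_ub cOm (oks n).1 (oks n.+1).1 Ox.
  have := (oks n.+1).2; have := (oks n).2.
  rewrite /a /b /= in r4 dn * => *.
  have : `|(s n).1 x - (nx (n, s n)).1 x| <= (s n).2 / 4 by exact: le_trans (ltW dn).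
  by rewrite ler_norml => /andP[? ?]; split; lra.
have Ha n m x : Om x -> (n <= m)%N -> a n x <= a m x.
  move=> Ox; elim: m => [|m IH]; first by rewrite leqn0 => /eqP->.
  rewrite leq_eqVlt => /orP[/eqP->//|/IH]; move/le_trans; apply.
  by have [] := Hab m x Ox.
have Hb n m x : Om x -> (n <= m)%N -> b m x <= b n x.
  move=> Ox; elim: m => [|m IH]; first by rewrite leqn0 => /eqP->.
  rewrite leq_eqVlt => /orP[/eqP->//|/IH]; apply: le_trans.
  by have [] := Hab m x Ox.
have ab n m x : Om x -> a n x <= b m x.
  move=> Ox; apply: le_trans (Ha _ (maxn n m) _ Ox (leq_maxl _ _)) _.
  apply: le_trans (Hb _ _ _ Ox (leq_maxr n m)).
  by rewrite /a /b; have := (oks (maxn n m)).2; lra.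
pose g x := sup (range (a ^~ x)).
have Hg n x : Om x -> `|(s n).1 x - g x| <= (s n).2 / 2.
  move=> Ox; have h1 : a n x <= g x.
    apply: sup_upper_bound; last by exists n.
    split; first by exists (a 0%N x), 0%N.
    by exists (b 0%N x) => _ [m _ <-]; exact: ab.
  have h2 : g x <= b n x.
    by apply: ge_sup; [exists (a 0%N x), 0%N|move=> _ [m _ <-]; exact: ab].
  by rewrite /a /b in h1 h2; rewrite ler_norml; apply/andP; split; lra.
have cg : cont_on Om g.
  move=> x Ox e e_gt0.
  pose n := Num.truncn (2 / e).
  have ne : n.+1%:R^-1 < e / 2.
    by rewrite invf_plt ?posrE ?divr_gt0 // invf_div; exact: truncnS_gt.
  have [k Hk] := (oks n.+1).1 x Ox (e / 2) (divr_gt0 e_gt0 (ltr0Sn R 1)).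
  exists k => y Oy xy.
  have rn : (s n.+1).2 < e / 2 by apply: le_lt_trans ne; have [] := Hs n.
  move: (s n.+1) rn (Hk y Oy xy) (Hg n.+1 x Ox) (Hg n.+1 y Oy) => p rn.
  rewrite ?ler_norml ?ltr_norml => /andP[? ?] /andP[? ?] /andP[? ?].
  by apply/andP; split; lra.
have sg n : supdist Om (s n).1 g < (s n).2.
  apply: (@le_lt_trans _ _ ((s n).2 / 2)); last by have := (oks n).2; lra.
  by apply: supdist_le => [|x Ox]; [have := (oks n).2; lra|exact: Hg].
exists g; last exact: (sg 0%N).
by move=> n _; have [_ _ _ _] := Hs n; apply => //; exact: (sg n.+1).
Qed.

End Topology.

(** * Loops in sofic shifts *)

Section Sofic.
Variables (A : finType).
Implicit Types (Om : set (seqsp A)) (x y z : seqsp A).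
Local Notation sigma := (@Defs.shift A).

Lemma iter_shift n x j : iter n sigma x j = x (j + n)%N.
Proof.
by elim: n j => [|n IH] j /=; rewrite ?addn0 // /Defs.shift IH addSnnS.
Qed.

Lemma subshift_iter Om n x : subshift Om -> Om x -> Om (iter n sigma x).
Proof. by move=> [_ sOm] Ox; elim: n => //= n IH; apply: sOm; exists (iter n sigma x). Qed.

Lemma languageP Om x n :
  language Om (mkseq x n) <-> exists2 y, Om y & cyl x n y.
Proof.
split=> -[y Oy xy]; exists y => // j; rewrite ?size_mkseq => jn.
  by rewrite xy ?size_mkseq // nth_mkseq.
by rewrite nth_mkseq // xy.
Qed.

Definition splice i x y : seqsp A := fun l => if (l < i)%N then x l else y (l - i)%N.

Lemma mkseq_splice i n x y :
  mkseq (splice i x y) (i + n) = mkseq x i ++ mkseq y n.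
Proof.
rewrite /mkseq iotaD map_cat; congr (_ ++ _).
  by apply/eq_in_map => l; rewrite mem_iota /splice => /andP[_ ->].
rewrite -{1}(addn0 (0 + i)%N) iotaDl -map_comp; apply/eq_in_map => l _ /=.
by rewrite /splice add0n ltnNge leq_addr /= addKn.
Qed.

Lemma iter_shift_splice i x y : iter i sigma (splice i x y) = y.
Proof. by apply/funext => l; rewrite iter_shift /splice ltnNge leq_addl /= addnK. Qed.

Lemma splice_iter i x : splice i x (iter i sigma x) = x.
Proof. by apply/funext => l; rewrite /splice iter_shift; case: ltnP => // /subnK ->. Qed.

(** Follower sets speak of finite words; closedness of [Om] extends the exchange of pasts to
    infinite tails. *)
Lemma follower_splice Om x i j y : subshift Om ->
  follower Om (mkseq x i) = follower Om (mkseq x j) ->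
  Om (splice i x y) -> Om (splice j x y).
Proof.
move=> sOm Fij Oi; have [cOm _] := sOm; apply: prod_closed_mem => // n.
have Oy : Om y by rewrite -(iter_shift_splice i x y); exact: subshift_iter.
have : follower Om (mkseq x i) (mkseq y n).
  split; first by apply/languageP; exists y.
  by rewrite -mkseq_splice; apply/languageP; exists (splice i x y).
rewrite Fij => -[_]; rewrite -mkseq_splice => /languageP[z Oz xz].
by exists z => //; apply: cyl_le xz; exact: leq_addl.
Qed.

(** There are at most Q pairs (follower set, window of length k), so two of the times 0 to Q share
    theirs. *)
Lemma sofic_pigeonhole Om k : sofic Om -> exists Q, forall x, exists i j,
  [/\ (i < j)%N, (j <= Q)%N, follower Om (mkseq x i) = follower Om (mkseq x j) &
      cyl (iter i sigma x) k (iter j sigma x)].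
Proof.
move=> /finite_seqP[s Hs].
have idx u : (index (follower Om u) s < size s)%N.
  rewrite index_mem; suff : [set` s] (follower Om u) by [].
  by rewrite -Hs; exists u.
pose T := ('I_(size s) * {ffun 'I_k -> A})%type.
exists #|{: T}| => x.
pose st (l : 'I_#|{: T}|.+1) : T :=
  (Ordinal (idx (mkseq x l)), [ffun t : 'I_k => x (t + l)%N]).
have /injectivePn[l [l' ll' ]] : ~~ injectiveb st.
  by apply/injectiveP => /leq_card; rewrite card_ord ltnn.
wlog lt : l l' ll' / (l < l')%N => [H|].
  move: ll'; rewrite neq_ltn => /orP[lt|lt].
    by apply: H => //; rewrite neq_ltn lt.
  by move=> e; apply: (H l' l) => //; rewrite neq_ltn lt.
move=> [/(congr1 (nth set0 s))].
rewrite !nth_index -?index_mem // => eF /ffunP eW.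
exists l, l'; split=> //; first by rewrite -ltnS.
move=> t tk; have := eW (Ordinal tk); rewrite !ffunE /= => e.
by rewrite !iter_shift.
Qed.

(** Equal follower sets allow the stretch from [i] to [j] to be removed; equal windows at [i] and
    [j] make the windows straddling the cut agree with the original ones. *)
Lemma sofic_excise Om k x i j : subshift Om -> Om x -> (i < j)%N ->
  follower Om (mkseq x i) = follower Om (mkseq x j) ->
  cyl (iter i sigma x) k (iter j sigma x) ->
  exists2 y, Om y &
    (forall l, (l < i)%N -> cyl (iter l sigma x) k (iter l sigma y)) /\
    (forall l, iter (i + l) sigma y = iter (j + l) sigma x).
Proof.
move=> sOm Ox ij Fij wij; exists (splice i x (iter j sigma x)).
  apply: (follower_splice sOm (esym Fij)); by rewrite splice_iter.
split=> [l li t tk|l].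
  rewrite !iter_shift /splice; case: ltnP => // il.
  rewrite iter_shift -{2}(subnK il).
  have /wij : (t + l - i < k)%N by lia.
  by rewrite !iter_shift.
by rewrite !(addnC _ l) !iterD iter_shift_splice.
Qed.

(** Repeating the loop any number of times stays in [Om] by equality of the follower sets; the
    periodic point is a limit of such points. *)
Lemma sofic_loop Om k x i j : subshift Om -> Om x -> (i < j)%N ->
  follower Om (mkseq x i) = follower Om (mkseq x j) ->
  cyl (iter i sigma x) k (iter j sigma x) ->
  exists2 z, Om z & iter (j - i) sigma z = z /\
    (forall l, (l < j - i)%N -> cyl (iter (i + l) sigma x) k (iter l sigma z)).
Proof.
move=> sOm Ox ij Fij wij; pose p := (j - i)%N.
have p0 : (0 < p)%N by rewrite subn_gt0.
pose z : seqsp A := fun l => x (i + l %% p)%N.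
(* [y m] runs through the loop m times and then follows [x] from time [i] on. *)
pose y := fix y n := if n is m.+1 then splice p (iter i sigma x) (y m)
                     else iter i sigma x.
have ysp m : splice j x (y m) = splice i x (y m.+1).
  apply/funext => l; rewrite /splice /= /splice iter_shift.
  have [li|il] := ltnP l i; first by rewrite (ltn_trans li ij).
  have -> : (l < j)%N = (l - i < p)%N by rewrite /p; lia.
  by rewrite subnK //; case: ltnP => // h; congr (y m _); rewrite /p in h *; lia.
have Oy m : Om (splice i x (y m)).
  elim: m => [|m IH]; first by rewrite /= splice_iter.
  by rewrite -ysp; exact: follower_splice IH.
have yz m : cyl z (m * p) (y m).
  elim: m => [|m IH] l //; rewrite mulSn /= /splice => lm.
  case: ltnP => lp; first by rewrite iter_shift /z modn_small // addnC.
  by rewrite IH; [rewrite /z -[in RHS](subnK lp) modnDr|lia].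
exists z.
  have [cOm _] := sOm; apply: prod_closed_mem => // n; exists (y n).
    by rewrite -(iter_shift_splice i x (y n)); exact: subshift_iter.
  by apply: cyl_le (yz n); rewrite leq_pmulr.
split; first by apply/funext => l; rewrite iter_shift /z modnDr.
(* The agreement reaches k letters beyond the first period because the windows at [i] and [j]
   coincide. Strong induction covers loops shorter than k. *)
have xz l : (l < p + k)%N -> x (i + l)%N = z l.
  elim/ltn_ind: l => l IH lpk; case: (ltnP l p) => lp; first by rewrite /z modn_small.
  have /wij : (l - p < k)%N by lia.
  rewrite !iter_shift.
  have -> : (l - p + j = i + l)%N by rewrite /p in lp *; lia.
  move=> ->; rewrite addnC IH; [|lia|lia].
  by rewrite /z -[in RHS](subnK lp) modnDr.
move=> l lp t tk; rewrite !iter_shift -xz; last by rewrite -/p in lp; lia.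
by congr x; lia.
Qed.

(** Periodic points are indexed by a finite type of words, over which weights can be summed. *)
Definition per q (w : {ffun 'I_q.+1 -> A}) : seqsp A := fun l => w (inord (l %% q.+1)).

Lemma iter_per q (w : {ffun 'I_q.+1 -> A}) : iter q.+1 sigma (per w) = per w.
Proof. by apply/funext => l; rewrite iter_shift /per modnDr. Qed.

Lemma iter_mul_shift p m x : iter p sigma x = x -> iter (m * p) sigma x = x.
Proof. by move=> px; elim: m => //= m IH; rewrite mulSn iterD IH. Qed.

Lemma periodic_perE q z : iter q.+1 sigma z = z ->
  z = per [ffun i : 'I_q.+1 => z i].
Proof.
move=> qz; apply/funext => l; rewrite /per ffunE inordK ?ltn_pmod //.
by rewrite {1}(divn_eq l q.+1) addnC -iter_shift iter_mul_shift.
Qed.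

Variable R : realType.
Implicit Types psi : seqsp A -> R.

Definition kdet Om k psi :=
  forall x y, Om x -> Om y -> cyl x k y -> psi x = psi y.

Definition birk n psi x : R := \sum_(l < n) psi (iter l sigma x).

(** The integral of [psi] against the measure equidistributed on the orbit of [per w]. *)
Definition pavg q (w : {ffun 'I_q.+1 -> A}) psi : R := birk q.+1 psi (per w) / q.+1%:R.

Lemma birkD m n psi x : birk (m + n) psi x = birk m psi x + birk n psi (iter m sigma x).
Proof.
rewrite /birk big_split_ord /=; congr (_ + _); apply: eq_bigr => i _.
by rewrite addnC iterD.
Qed.

Lemma birk_periodic m p psi z : iter p sigma z = z ->
  birk (m * p) psi z = m%:R * birk p psi z.
Proof.
move=> pz; elim: m => [|m IH]; first by rewrite mul0r /birk big_ord0.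
by rewrite mulSn birkD pz IH -natr1 mulrDl mul1r addrC.
Qed.

(* Cutting out loops in the graph of pairs (follower set of the past, window of
   length k) writes a Birkhoff sum as a sum over periodic orbits of bounded
   period, up to a remainder of bounded length. *)
Lemma birk_decomposition Om k : subshift Om -> sofic Om ->
  exists Q q, forall n x, Om x ->
  exists (a : {ffun 'I_q.+1 -> A} -> R) (r : nat) y,
    [/\ forall w, 0 <= a w, forall w, ~ Om (per w) -> a w = 0, (r <= Q)%N, Om y &
     forall psi, kdet Om k psi ->
       birk n psi x = \sum_w a w * pavg w psi + birk r psi y].
Proof.
move=> sOm soOm; have [Q HQ] := sofic_pigeonhole k soOm.
have QE : Q`!.-1.+1 = Q`! by rewrite prednK // fact_gt0.
(* A loop has length at most Q, which divides Q!, so all loops are words of the common period Q!. *)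
exists Q, Q`!.-1.
elim/ltn_ind => n IH x Ox.
have [nQ|Qn] := leqP n Q.
  exists (fun=> 0), n, x; split => // psi _.
  by rewrite big1 ?add0r // => w _; rewrite mul0r.
have [i [j [ij jQ Fij wij]]] := HQ x.
have [y Oy [xy1 xy2]] := sofic_excise sOm Ox ij Fij wij.
have [z Oz [pz xz]] := sofic_loop sOm Ox ij Fij wij.
set p := (j - i)%N in pz xz.
have p0 : (0 < p)%N by rewrite subn_gt0.
have [|a [r [y' [a0 aOm rQ Oy' H]]]] := IH (n - p)%N _ y Oy; first by lia.
have pQ : (p %| Q`!)%N by apply: dvdn_fact; rewrite p0 /=; lia.
have [m mE] := dvdnP pQ.
have zq : iter Q`!.-1.+1 sigma z = z by rewrite QE mE iter_mul_shift.
pose w0 : {ffun 'I_Q`!.-1.+1 -> A} := [ffun l : 'I_Q`!.-1.+1 => z l].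
have zw0 : z = per w0 by exact: periodic_perE.
(* [pavg] is an average per step, so a loop of length [p] enters with weight [p]. *)
exists (fun w => a w + p%:R *+ (w == w0)), r, y'; split => //.
- by move=> w; rewrite addr_ge0 // mulrn_wge0.
- move=> w nOw; rewrite aOm // add0r; case: eqP => //= ww0.
  by exfalso; apply: nOw; rewrite ww0 -zw0.
move=> psi kpsi.
have -> : \sum_w (a w + p%:R *+ (w == w0)) * pavg w psi =
    \sum_w a w * pavg w psi + birk p psi z.
  under eq_bigr do rewrite mulrDl.
  rewrite big_split /=; congr (_ + _).
  rewrite (bigD1 w0) //= eqxx mulr1n big1 ?addr0; last first.
    by move=> w /negPf->; rewrite mulr0n mul0r.
  rewrite /pavg -zw0 QE mE birk_periodic // natrM.
  have : m%:R != 0 :> R by rewrite pnatr_eq0; apply: contraTneq (fact_gt0 Q) => m0; rewrite mE m0.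
  have : p%:R != 0 :> R by rewrite pnatr_eq0 -lt0n.
  by move=> *; field; apply/andP.
rewrite addrAC -H //.
have -> : n = (i + (p + (n - j)))%N by rewrite /p; lia.
have -> : (i + (p + (n - j)) - p = i + (n - j))%N by lia.
rewrite !birkD -[in RHS]addrA; congr (_ + _).
  apply: eq_bigr => l _; apply: kpsi; [exact: subshift_iter|exact: subshift_iter|exact: xy1].
rewrite [LHS]addrC; congr (_ + _).
  have := xy2 0%N; rewrite !addn0 => ->.
  rewrite -iterD; congr (birk _ _ (iter _ _ _)); rewrite /p; lia.
apply: eq_bigr => l _; rewrite -iterD; apply: kpsi; [exact: subshift_iter|exact: subshift_iter|].
by rewrite addnC; exact: xz.
Qed.

End Sofic.

(** * Finite combinations of indicators *)

Section FiniteProbability.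
Context (d : measure_display) (T : measurableType d) (R : realType).
Variable mu : probability T R.

Definition pr (B : set T) : R := fine (mu B).

Lemma prE B : measurable B -> mu B = (pr B)%:E.
Proof. by move=> mB; rewrite /pr fineK // fin_num_measure. Qed.

Lemma pr_ge0 B : 0 <= pr B.
Proof. exact: fine_ge0. Qed.

Lemma le_pr B C : measurable B -> measurable C -> B `<=` C -> pr B <= pr C.
Proof.
by move=> mB mC BC; rewrite -lee_fin -!prE // le_measure ?inE.
Qed.

Lemma prT : pr setT = 1.
Proof. by rewrite /pr probability_setT. Qed.

Lemma pr_full_setI B D : measurable B -> measurable D -> mu D = 1%E -> mu (B `&` D) = mu B.
Proof.
move=> mB mD D1.
have mBD : measurable (B `&` D) by exact: measurableI.
have mBC : measurable (B `&` ~` D) by apply: measurableI => //; exact: measurableC.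
have e0 : mu (B `&` ~` D) = 0%E.
  apply/eqP; rewrite eq_le measure_ge0 andbT.
  apply: (@le_trans _ _ (mu (~` D))).
    by rewrite le_measure ?inE //; exact: measurableC.
  by rewrite probability_setC // D1 subee.
have -> : mu B = (mu (B `&` D) + mu (B `&` ~` D))%E.
  rewrite -measureU //; first by rewrite -setIUr setUv setIT.
  by apply/seteqP; split=> // x [[_ ?] [_]].
by rewrite e0 adde0.
Qed.

Lemma integrable_indic_comb D (I : finType) (c : I -> R) (B : I -> set T) :
  measurable D -> (forall i, measurable (B i)) ->
  mu.-integrable D (fun x => (\sum_i c i * \1_(B i) x)%:E).
Proof.
move=> mD mB.
rewrite (_ : (fun _ => _) = fun x => (\sum_i (c i)%:E * (\1_(B i) x)%:E)%E); last first.
  by apply/funext => x; rewrite -sumEFin.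
apply: integrable_sum => // i _; apply: integrableZl => //.
by apply: (@integrableS _ _ _ _ setT) => //; exact: integrable_indic.
Qed.

Lemma integral_indic_comb D (I : finType) (c : I -> R) (B : I -> set T) :
  measurable D -> mu D = 1%E -> (forall i, measurable (B i)) ->
  (\int[mu]_(x in D) (\sum_i c i * \1_(B i) x)%:E = (\sum_i c i * pr (B i))%:E)%E.
Proof.
move=> mD D1 mB.
rewrite (eq_integral (fun x => (\sum_i (c i)%:E * (\1_(B i) x)%:E)%E)); last first.
  by move=> x _; rewrite -sumEFin.
have iB i : mu.-integrable D (fun x => (\1_(B i) x)%:E).
  by apply: (@integrableS _ _ _ _ setT) => //; exact: integrable_indic.
rewrite integral_sum //; last by move=> i; apply: integrableZl.
rewrite -sumEFin; apply: eq_bigr => i _.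
rewrite integralZl // integral_indic // EFinM -prE //; congr (_ * _)%E.
exact: pr_full_setI.
Qed.

(** Reduces inequalities between combinations of probabilities to pointwise ones between step
    functions. *)
Lemma indic_comb_le (I J : finType) (c : I -> R) (B : I -> set T)
    (c' : J -> R) (B' : J -> set T) :
  (forall i, measurable (B i)) -> (forall j, measurable (B' j)) ->
  (forall x, \sum_i c i * \1_(B i) x <= \sum_j c' j * \1_(B' j) x) ->
  \sum_i c i * pr (B i) <= \sum_j c' j * pr (B' j).
Proof.
move=> mB mB' le; have T1 := probability_setT mu.
rewrite -lee_fin -!(integral_indic_comb _ measurableT) //.
apply: le_integral => //; [exact: integrable_indic_comb|exact: integrable_indic_comb|].
by move=> x _; rewrite lee_fin.
Qed.

Lemma integral_dist_le D (f g : T -> R) (r : R) : measurable D -> mu D = 1%E ->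
  mu.-integrable D (EFin \o f) -> mu.-integrable D (EFin \o g) ->
  (forall x, D x -> `|f x - g x| <= r) ->
  `|fine (\int[mu]_(x in D) (f x)%:E) - fine (\int[mu]_(x in D) (g x)%:E)| <= r.
Proof.
move=> mD D1 fi gi fg; rewrite -RintegralB //.
apply: le_trans (le_normr_Rintegral _ _) _ => //.
  exact: (@integrableB _ _ _ mu D mD (EFin \o f) (EFin \o g)).
have -> : r = \int[mu]_(x in D) r.
  by rewrite Rintegral_cst //; have -> : fine (mu D) = 1; rewrite ?D1 ?mulr1.
apply: le_Rintegral => //; last exact: finite_measure_integrable_cst.
exact: (integrable_norm (integrableB mD fi gi)).
Qed.

Lemma discrete_prob (I : finType) (c : I -> R) (pt : I -> T) :
  (forall i, 0 <= c i) -> \sum_i c i = 1 ->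
  exists P : probability T R, forall B, measurable B ->
    P B = (\sum_i c i * \1_B (pt i))%:E.
Proof.
move=> c0 c1.
pose cn k : R := if insub k is Some j then c (enum_val (j : 'I_#|I|)) else 0.
have cn0 k : 0 <= cn k by rewrite /cn; case: insubP.
pose ptn k : T := if insub k is Some j then pt (enum_val (j : 'I_#|I|)) else point.
pose m : {measure set T -> \bar R} := msum (fun k => mscale (NngNum (cn0 k)) (dirac (ptn k))) #|I|.
have mE B : m B = (\sum_i c i * \1_B (pt i))%:E.
  rewrite /m /= /msum -sumEFin (reindex (@enum_val I I)) /=; last first.
    by exists enum_rank => i _; [exact: enum_valK|exact: enum_rankK].
  apply: eq_bigr => i _; rewrite /mscale /= diracE EFinM.
  by rewrite /cn /ptn (valK i) indicE.
have m1 : m setT = 1%E.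
  by rewrite mE -[in RHS]c1; congr (_%:E); apply: eq_bigr => i _; rewrite indicT mulr1.
(* The mass is already 1; normalizing only supplies the type [probability]. *)
exists (mnormalize m (dirac point)) => B _.
rewrite /= /mnormalize m1 onee_eq0 /= invr1 mule1; exact: mE.
Qed.

End FiniteProbability.

(** * Invariant measures on the full shift *)

Section ShiftMeasure.
Variables (A : finType) (a0 : A) (R : realType).
Local Notation X := (g_sigma_algebraType (@borel_open A a0)).
Local Notation sigma := (@Defs.shift A).
Implicit Types (Om : set (seqsp A)) (x y z : seqsp A) (mu : probability X R).

Lemma open_measurable_seq (U : set (seqsp A)) : prod_open U -> measurable (U : set X).
Proof. by move=> oU; exact: sub_sigma_algebra. Qed.

Lemma closed_measurable_seq Om : prod_closed Om -> measurable (Om : set X).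
Proof. by move=> /open_measurable_seq/measurableC; rewrite setCK. Qed.

Lemma det_measurable m (B : set (seqsp A)) :
  (forall x y, cyl x m y -> B x -> B y) -> measurable (B : set X).
Proof. by move=> H; apply: open_measurable_seq => x Bx; exists m => y /H; exact. Qed.

Lemma iter_shift_measurable n (B : set X) :
  measurable B -> measurable (iter n sigma @^-1` B : set X).
Proof.
move=> mB; rewrite -[X in measurable X]setTI.
suff : measurable_fun setT (iter n sigma : X -> X) by exact.
apply: (@measurability _ _ X X setT _ (@borel_open A a0)) => // _ [U oU <-].
rewrite setTI; apply: open_measurable_seq => x /oU[m sub]; exists (m + n)%N => y xy.
by apply: sub => j jm; rewrite !iter_shift xy // ltn_add2r.
Qed.

Lemma itinerary_measurable (xi : seq (set X)) n (u : {ffun 'I_n -> 'I_(size xi)}) :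
  (forall i, (i < size xi)%N -> measurable (nth set0 xi i)) ->
  measurable ([set x | forall i : 'I_n, nth set0 xi (u i) (iter i sigma x)] : set X).
Proof.
move=> mxi.
rewrite (_ : [set x | _] =
    \bigcap_(i in [set: 'I_n]) (iter i sigma @^-1` nth set0 xi (u i))).
  apply: fin_bigcap_measurable; first exact: finite_finset.
  by move=> i _; apply: iter_shift_measurable; exact: mxi.
by apply/seteqP; split=> x H i; [move=> _|]; exact: H.
Qed.

Lemma inv_meas_iter Om mu n (B : set X) : inv_meas Om mu -> measurable B ->
  mu (iter n sigma @^-1` B) = mu B.
Proof.
move=> [_ inv] mB; elim: n => // n IH.
rewrite -[RHS]IH -(inv _ (iter_shift_measurable n mB)); congr (mu _).
by apply/seteqP; split=> x /=; rewrite -iterSr.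
Qed.

Lemma cont_on_measurable Om (f : seqsp A -> R) : prod_closed Om -> cont_on Om f ->
  measurable_fun (Om : set X) (f : X -> R).
Proof.
move=> cOm cf.
apply: (measurability _ (measurable_realfun.RGenOInfty.measurableE R)) => _ [_ [a ->] <-].
(* Continuity is known only along [Om]: [U] is an open set of the full shift whose trace on [Om] is
   the superlevel set. *)
pose U : set (seqsp A) :=
  [set z | exists x n, [/\ cyl x n z & forall y, Om y -> cyl x n y -> a < f y]].
rewrite (_ : _ `&` _ = Om `&` U).
  apply: measurableI; first exact: closed_measurable_seq.
  apply: open_measurable_seq => x [z [n [zx H]]]; exists n => y xy.
  by exists z, n; split => //; exact: cyl_trans zx xy.
apply/seteqP; split=> x [Ox /=]; rewrite in_itv /= andbT.
  move=> ax; split => //.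
  have [|n Hn] := cf x Ox (f x - a); first by rewrite subr_gt0.
  exists x, n; split=> // y Oy xy; have := Hn y Oy xy.
  by rewrite ltr_norml => /andP[_]; lra.
by move=> [z [n [zx H]]]; split=> //; exact: H.
Qed.

Lemma cont_on_integrable Om mu (f : seqsp A -> R) : prod_closed Om -> cont_on Om f ->
  mu.-integrable (Om : set X) (EFin \o f).
Proof.
move=> cOm cf; have mOm := closed_measurable_seq cOm.
apply: measurable_bounded_integrable => //.
- by rewrite -ge0_fin_numE // fin_num_measure.
- exact: cont_on_measurable.
have [N HN] := cont_on_bounded cOm cf.
exists N%:R; split; first exact: num_real.
by move=> M NM x /= Ox; apply: le_trans (HN x Ox) _; exact: ltW.
Qed.

Lemma integ_dist_le Om mu (f g : seqsp A -> R) (r : R) : prod_closed Om ->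
  mu Om = 1%E -> cont_on Om f -> cont_on Om g ->
  (forall x, Om x -> `|f x - g x| <= r) ->
  `|integ Om mu f - integ Om mu g| <= r.
Proof.
move=> cOm Om1 cf cg fg.
apply: (@integral_dist_le _ X R mu Om f g) => //.
- exact: closed_measurable_seq.
- exact: cont_on_integrable.
- exact: cont_on_integrable.
Qed.

Lemma kdet_cont Om k (psi : seqsp A -> R) : kdet Om k psi -> cont_on Om psi.
Proof.
move=> kpsi x Ox e e0; exists k => y Oy xy.
by rewrite (kpsi x y) // subrr normr0.
Qed.

Definition wcyl k (w : {ffun 'I_k -> A}) : set (seqsp A) :=
  [set x | forall j : 'I_k, x j = w j].

Lemma wcyl_measurable k (w : {ffun 'I_k -> A}) : measurable (wcyl w : set X).
Proof.
apply: (@det_measurable k) => x y xy wx j.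
by rewrite xy // wx.
Qed.

Lemma wcyl_cyl k (w : {ffun 'I_k -> A}) x y : wcyl w x -> wcyl w y -> cyl x k y.
Proof. by move=> wx wy j jk; have := wx (Ordinal jk); have := wy (Ordinal jk) => /= -> ->. Qed.

Definition word k x : {ffun 'I_k -> A} := [ffun j : 'I_k => x j].

Lemma wcylE k (w : {ffun 'I_k -> A}) x : wcyl w x <-> word k x = w.
Proof.
split=> [wx|<- j]; last by rewrite ffunE.
by apply/ffunP => j; rewrite ffunE wx.
Qed.

(* Meaningful only when [wcyl w] meets [Om]; otherwise [get] returns the
   default point. *)
Definition rep Om k (w : {ffun 'I_k -> A}) : seqsp A :=
  get ([set x | Om x /\ wcyl w x] : set (pseq a0)).

Lemma repP Om k (w : {ffun 'I_k -> A}) x : Om x -> wcyl w x ->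
  Om (rep Om w) /\ wcyl w (rep Om w).
Proof.
move=> Ox wx.
exact: (@getPex (pseq a0) [set x | Om x /\ wcyl w x] (ex_intro _ x (conj Ox wx))).
Qed.

Lemma kdet_sum Om k (psi : seqsp A -> R) x : kdet Om k psi -> Om x ->
  psi x = \sum_(w : {ffun 'I_k -> A}) psi (rep Om w) * \1_(wcyl w) x.
Proof.
move=> kpsi Ox; have wx : wcyl (word k x) x by apply/wcylE.
rewrite (bigD1 (word k x)) //= indicE mem_set // mulr1 big1 ?addr0; last first.
  move=> w /eqP wn; rewrite indicE memNset ?mulr0 //.
  by move=> /wcylE/esym.
have [Or wr] := repP Ox wx.
by apply: kpsi => //; exact: wcyl_cyl wx wr.
Qed.

(** The right-hand side is free of [l], because invariance applies to each cylinder. *)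
Lemma integ_kdet_iter Om mu k l (psi : seqsp A -> R) : subshift Om -> inv_meas Om mu ->
  kdet Om k psi -> integ Om mu (psi \o iter l sigma) =
  \sum_(w : {ffun 'I_k -> A}) psi (rep Om w) * pr mu (wcyl w).
Proof.
move=> sOm imu kpsi; have [cOm _] := sOm; have [Om1 _] := imu.
rewrite /integ (@eq_integral _ X R mu Om
  (fun x => (\sum_(w : {ffun 'I_k -> A}) psi (rep Om w) * \1_(iter l sigma @^-1` wcyl w) x)%:E)).
  rewrite integral_indic_comb //=.
  - apply: eq_bigr => w _; congr (_ * _); congr fine.
    by apply: (inv_meas_iter _ imu); exact: wcyl_measurable.
  - exact: closed_measurable_seq.
  - by move=> w; apply: iter_shift_measurable; exact: wcyl_measurable.
move=> x /set_mem Ox /=; congr (_%:E).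
by rewrite {1}(kdet_sum kpsi) //; exact: subshift_iter.
Qed.

Lemma integ_kdet Om mu k (psi : seqsp A -> R) : prod_closed Om -> mu Om = 1%E ->
  kdet Om k psi -> integ Om mu psi =
  \sum_(w : {ffun 'I_k -> A}) psi (rep Om w) * pr mu (wcyl w).
Proof.
move=> cOm Om1 kpsi.
rewrite /integ (@eq_integral _ X R mu Om
  (fun x => (\sum_(w : {ffun 'I_k -> A}) psi (rep Om w) * \1_(wcyl w) x)%:E)).
  rewrite integral_indic_comb //=.
  - exact: closed_measurable_seq.
  - by move=> w; exact: wcyl_measurable.
by move=> x /set_mem Ox; rewrite {1}(kdet_sum kpsi).
Qed.

(** A representative outside [Om] means that the cylinder misses [Om]. *)
Lemma pr_wcyl0 Om mu k (w : {ffun 'I_k -> A}) : prod_closed Om -> mu Om = 1%E ->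
  ~ Om (rep Om w) -> pr mu (wcyl w) = 0.
Proof.
move=> cOm Om1 nr; rewrite /pr -(@pr_full_setI _ X R mu (wcyl w) Om) //; first last.
- exact: closed_measurable_seq.
- exact: wcyl_measurable.
rewrite (_ : _ `&` _ = set0) ?measure0 //.
by apply/seteqP; split=> // x [wx Ox]; apply: nr; have [] := repP Ox wx.
Qed.

Lemma kdet_birk Om k n (psi : seqsp A -> R) : subshift Om -> kdet Om k psi ->
  kdet Om (n + k) (birk n psi).
Proof.
move=> sOm kpsi x y Ox Oy xy; apply: eq_bigr => l _.
apply: kpsi; [exact: subshift_iter|exact: subshift_iter|move=> j jk].
by rewrite !iter_shift xy //; have := ltn_ord l; lia.
Qed.

Lemma kdet_comp_iter Om k l (psi : seqsp A -> R) : subshift Om -> kdet Om k psi ->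
  kdet Om (l + k) (psi \o iter l sigma).
Proof.
move=> sOm kpsi x y Ox Oy xy /=.
apply: kpsi; [exact: subshift_iter|exact: subshift_iter|move=> j jk].
by rewrite !iter_shift xy //; lia.
Qed.

Lemma kdet_le Om k k' (psi : seqsp A -> R) : (k <= k')%N -> kdet Om k psi -> kdet Om k' psi.
Proof. by move=> kk kpsi x y Ox Oy xy; apply: kpsi => //; exact: cyl_le xy. Qed.

Lemma integ_birk Om mu k n (psi : seqsp A -> R) : subshift Om -> inv_meas Om mu ->
  kdet Om k psi -> integ Om mu (birk n psi) = n%:R * integ Om mu psi.
Proof.
move=> sOm imu kpsi; have [cOm _] := sOm; have [Om1 _] := imu.
rewrite (integ_kdet cOm Om1 (kdet_birk (n := n) sOm kpsi)).
under eq_bigr do rewrite mulr_suml.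
rewrite exchange_big /= (eq_bigr (fun=> integ Om mu psi)).
  by rewrite sumr_const card_ord mulr_natl.
move=> l _; rewrite [RHS](integ_kdet cOm Om1 kpsi) -(integ_kdet_iter l sOm imu kpsi).
rewrite (integ_kdet (k := n + k) cOm Om1) //.
by apply: kdet_le (kdet_comp_iter (l := l) sOm kpsi); rewrite leq_add2r ltnW.
Qed.

Lemma sum_pr_wcyl Om mu k : prod_closed Om -> mu Om = 1%E ->
  \sum_(w : {ffun 'I_k -> A}) pr mu (wcyl w) = 1.
Proof.
move=> cOm Om1; have k1 : kdet Om k (fun=> 1 : R) by [].
have := integ_kdet cOm Om1 k1; under eq_bigr do rewrite mul1r.
move=> <-; rewrite /integ.
have := @integral_cst _ X R mu Om (closed_measurable_seq cOm) 1%E.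
rewrite /cst => ->; have e : (1 * mu Om = 1)%E by rewrite Om1 mul1e.
exact: (congr1 fine e).
Qed.

End ShiftMeasure.

(** * Periodic replicas *)

Lemma finite_cluster (R : realType) (I : finType) (t : nat -> I -> R) :
  (forall n i, 0 <= t n i <= 1) ->
  exists v : I -> R, forall e : R, 0 < e -> forall n0, exists2 n, (n0 <= n)%N &
    forall i, `|t n i - v i| < e.
Proof.
move=> t01.
pose K := [set v : 'rV[R]_#|I| | forall i, [set` `[0, 1]%R] (v ord0 i)].
have cK : compact K.
  exact: (@rV_compact R #|I| (fun=> `[0, 1]%classic) (fun=> @segment_compact R 0 1)).
pose T n : 'rV[R]_#|I| := \row_i t n (enum_val i).
have [|v [_ clv]] := cK (T @ \oo) (fmap_proper_filter T _).
  by exists 0%N => // n _ i /=; rewrite mxE in_itv /=; exact: t01.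
exists (fun i => v ord0 (enum_rank i)) => e e0 n0.
have [|_ [[n nn0 <-] [_ bv]]] := clv (T @` [set n | (n0 <= n)%N]) (ball v e) _ (nbhsx_ballx v e e0).
  by exists n0 => // n n0n; exists n.
exists n => // i; have := bv ord0 (enum_rank i).
by rewrite /ball /= mxE enum_rankK distrC.
Qed.

Lemma eqr_dist_lt (R : realType) (a b : R) :
  (forall e, 0 < e -> `|a - b| < e) -> a = b.
Proof.
move=> H; apply/eqP; rewrite -subr_eq0 -normr_le0 leNgt; apply/negP => /H.
by rewrite ltxx.
Qed.

Section PeriodicReplica.
Variables (A : finType) (a0 : A) (R : realType).
Local Notation X := (g_sigma_algebraType (@borel_open A a0)).
Local Notation sigma := (@Defs.shift A).
Implicit Types (Om : set (seqsp A)) (x y z : seqsp A) (mu : probability X R).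

(** Integrates [birk_decomposition], word by word, and divides by the number of steps. The remainder
    has at most Q terms bounded by M. The weights do not depend on [psi], nor the period on [mu] and
    [n]. *)
Lemma periodic_marginals_approx Om k : subshift Om -> sofic Om ->
  exists (Q q : nat), forall mu, inv_meas Om mu -> forall n,
  exists t : {ffun 'I_q.+1 -> A} -> R,
    [/\ forall w, 0 <= t w, forall w, ~ Om (per w) -> t w = 0 &
    forall psi M, kdet Om k psi -> (forall x, Om x -> `|psi x| <= M) ->
      `|integ Om mu psi - \sum_w t w * pavg w psi| <= Q%:R * M / n.+1%:R].
Proof.
move=> sOm soOm; have [cOm _] := sOm.
have [Q [q dec]] := birk_decomposition R k sOm soOm.
exists Q, q => mu imu n; have [Om1 _] := imu.
pose W := {ffun 'I_(n.+1 + k) -> A}.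
(* Words without a representative in [Om] have probability 0 and receive arbitrary weights. *)
have /choice[a Ha] (u : W) : exists a : {ffun 'I_q.+1 -> A} -> R,
   (forall w, 0 <= a w) /\ (Om (rep a0 Om u) -> (forall w, ~ Om (per w) -> a w = 0) /\
    exists r y, [/\ (r <= Q)%N, Om y & forall psi, kdet Om k psi ->
     birk n.+1 psi (rep a0 Om u) = \sum_w a w * pavg w psi + birk r psi y]).
  have [Or|nOr] := pselect (Om (rep a0 Om u)); last by exists (fun=> 0).
  have [a [r [y [a_ge0 aOm rQ Oy H]]]] := dec n.+1 _ Or.
  by exists a; split=> // _; split=> //; exists r, y.
pose p (u : W) := pr mu (wcyl u).
have p0 u : ~ Om (rep a0 Om u) -> p u = 0 by exact: pr_wcyl0.
have n1 : 0 < n.+1%:R :> R by rewrite ltr0Sn.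
exists (fun w => \sum_u p u * a u w / n.+1%:R); split.
- move=> w; apply: sumr_ge0 => u _; apply: divr_ge0 => //; apply: mulr_ge0; first exact: pr_ge0.
  by have [] := Ha u.
- move=> w nOw; apply: big1 => u _.
  have [Or|/p0 ->] := pselect (Om (rep a0 Om u)); last by rewrite !mul0r.
  by have [_ /(_ Or)[-> //]] := Ha u; rewrite mulr0 mul0r.
move=> psi M kpsi psiM.
have -> : integ Om mu psi = \sum_u p u * birk n.+1 psi (rep a0 Om u) / n.+1%:R.
  rewrite -mulr_suml; apply: (mulIf (lt0r_neq0 n1)); rewrite divfK ?lt0r_neq0 //.
  rewrite mulrC -(integ_birk n.+1 sOm imu kpsi).
  rewrite (integ_kdet cOm Om1 (kdet_birk (n := n.+1) sOm kpsi)).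
  by apply: eq_bigr => u _; rewrite mulrC.
have -> : \sum_w (\sum_u p u * a u w / n.+1%:R) * pavg w psi =
    \sum_u p u * (\sum_w a u w * pavg w psi) / n.+1%:R.
  under eq_bigr do rewrite mulr_suml.
  rewrite exchange_big /=; apply: eq_bigr => u _.
  by rewrite mulr_sumr mulr_suml; apply: eq_bigr => w _; ring.
rewrite -sumrB; apply: le_trans (ler_norm_sum _ _ _) _.
rewrite -[leRHS]mul1r -[X in _ <= X * _](sum_pr_wcyl (n.+1 + k) cOm Om1) mulr_suml.
apply: ler_sum => u _.
have [Or|/p0 pu0] := pselect (Om (rep a0 Om u)); last first.
  by rewrite -/(p u) pu0 !mul0r subrr normr0.
have [_ /(_ Or)[_ [r [y [rQ Oy H]]]]] := Ha u.
have -> : p u * birk n.+1 psi (rep a0 Om u) / n.+1%:R -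
    p u * (\sum_w a u w * pavg w psi) / n.+1%:R = p u * birk r psi y / n.+1%:R.
  by rewrite H //; ring.
have n1V : 0 <= n.+1%:R^-1 :> R by rewrite invr_ge0 ltW.
rewrite normrM (ger0_norm n1V) normrM (ger0_norm (pr_ge0 _ _)) mulrA.
rewrite ler_wpM2r // ler_wpM2l ?pr_ge0 //.
apply: le_trans (ler_norm_sum _ _ _) _.
apply: (@le_trans _ _ (\sum_(l < r) M)).
  by apply: ler_sum => l _; apply: psiM; exact: subshift_iter.
have M0 : 0 <= M by apply: le_trans (psiM y Oy).
by rewrite sumr_const card_ord -[M *+ r]mulr_natl ler_wpM2r // ler_nat.
Qed.

Lemma kdet_bounded Om k (psi : seqsp A -> R) : prod_closed Om -> kdet Om k psi ->
  exists2 M : R, 0 <= M & forall x, Om x -> `|psi x| <= M.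
Proof. by move=> cOm /kdet_cont/(cont_on_bounded cOm)[N HN]; exists N%:R. Qed.

Lemma integ_cst1 Om mu : prod_closed Om -> mu Om = 1%E -> integ Om mu (fun=> 1) = 1.
Proof.
move=> cOm Om1; rewrite (@integ_kdet _ _ _ Om mu 0) //.
under eq_bigr do rewrite mul1r.
exact: (sum_pr_wcyl 0 cOm Om1).
Qed.

Lemma pavg_cst1 q (w : {ffun 'I_q.+1 -> A}) : pavg w (fun=> 1) = 1 :> R.
Proof. by rewrite /pavg /birk sumr_const card_ord divff // pnatr_eq0. Qed.

(** Testing the approximation on the constant 1 bounds the total weights uniformly in [n]; a cluster
    point, found by compactness of a cube after division by the bound [C], satisfies the identity
    exactly. *)
Lemma periodic_marginals Om k : subshift Om -> sofic Om ->
  exists q : nat, forall mu, inv_meas Om mu ->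
  exists t : {ffun 'I_q.+1 -> A} -> R,
    [/\ forall w, 0 <= t w, forall w, ~ Om (per w) -> t w = 0, \sum_w t w = 1 &
    forall psi, kdet Om k psi -> integ Om mu psi = \sum_w t w * pavg w psi].
Proof.
move=> sOm soOm; have [cOm _] := sOm.
have [Q [q H]] := periodic_marginals_approx k sOm soOm.
exists q => mu imu; have [Om1 _] := imu.
have [t Ht] := choice (H mu imu).
have k1 : kdet Om k (fun=> 1 : R) by [].
have tsum n : \sum_w t n w <= 1 + Q%:R.
  have [_ _ /(_ _ 1 k1)] := Ht n; rewrite integ_cst1 //.
  have -> : \sum_w t n w * pavg w (fun=> 1) = \sum_w t n w.
    by apply: eq_bigr => w _; rewrite pavg_cst1 mulr1.
  have : Q%:R / n.+1%:R <= Q%:R :> R.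
    by rewrite ler_pdivrMr ?ltr0Sn // ler_peMr // ler1n.
  move=> h /(_ _)/(le_trans)-/(_ _) h2.
  have : `|1 - \sum_w t n w| <= Q%:R by apply: h2; rewrite ?mulr1 // => x _; rewrite normr1.
  by rewrite ler_norml => /andP[]; lra.
pose C : R := 1 + Q%:R.
have C0 : 0 < C by rewrite /C ltr_pwDl.
have [|v Hv] := @finite_cluster R {ffun 'I_q.+1 -> A} (fun n w => t n w / C).
  move=> n w; have [t0 _ _] := Ht n; rewrite divr_ge0 ?t0 ?(ltW C0) //=.
  rewrite ler_pdivrMr // mul1r; apply: le_trans (tsum n).
  by rewrite (bigD1 w) //= lerDl sumr_ge0.
have {}Hv e : 0 < e -> forall n0, exists2 n, (n0 <= n)%N & forall w, `|t n w - v w * C| < e.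
  move=> e0 n0; have [|n n0n Hn] := Hv (e / C) _ n0; first by rewrite divr_gt0.
  exists n => // w; have := Hn w; rewrite ltr_pdivlMr //.
  by rewrite -{2}(ger0_norm (ltW C0)) -normrM mulrBl divfK ?lt0r_neq0.
have key psi : kdet Om k psi -> integ Om mu psi = \sum_w (v w * C) * pavg w psi.
  move=> kpsi; have [M M0 psiM] := kdet_bounded cOm kpsi.
  apply: eqr_dist_lt => e e0.
  pose B : R := \sum_(w : {ffun 'I_q.+1 -> A}) `|pavg w psi|.
  have B0 : 0 <= B by exact: sumr_ge0.
  have [|n nn0 Hn] := Hv (e / (2 * (B + 1))) _ (Num.truncn (2 * (Q%:R * M) / e)).
    by rewrite divr_gt0 // mulr_gt0 // ltr_pwDr.
  have [_ _ /(_ psi M kpsi psiM) h1] := Ht n.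
  have h2 : Q%:R * M / n.+1%:R < e / 2.
    have : 2 * (Q%:R * M) / e < n.+1%:R.
      by apply: lt_le_trans (truncnS_gt _) _; rewrite ler_nat ltnS.
    rewrite !ltr_pdivrMr ?ltr0Sn //; move: (n.+1%:R) => n1.
    by lra.
  have h3 : `|\sum_w t n w * pavg w psi - \sum_w v w * C * pavg w psi| <= e / 2.
    rewrite -sumrB; apply: le_trans (ler_norm_sum _ _ _) _.
    apply: (@le_trans _ _ (e / (2 * (B + 1)) * B)).
      rewrite mulr_sumr; apply: ler_sum => w _.
      by rewrite -mulrBl normrM ler_wpM2r // ltW.
    by rewrite mulrAC ler_pdivrMr ?mulr_gt0 ?ltr_pwDr //; lra.
  apply: le_lt_trans (ler_distD (\sum_w t n w * pavg w psi) _ _) _.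
  by rewrite [ltRHS]splitr; apply: ltr_leD => //; exact: le_lt_trans h2.
exists (fun w => v w * C); split=> //.
- move=> w; rewrite leNgt; apply/negP => vw.
  have [|n _ Hn] := Hv (- (v w * C)) _ 0%N; first by rewrite oppr_gt0.
  have [t0 _ _] := Ht n; have := Hn w; have := t0 w.
  by rewrite ltr_norml => ? /andP[_]; lra.
- move=> w nOw; apply/esym/eqr_dist_lt => e e0.
  have [n _ Hn] := Hv e e0 0%N; have [_ t0 _] := Ht n.
  by rewrite -(t0 w nOw).
- have := key _ k1; rewrite integ_cst1 // => ->.
  by apply: eq_bigr => w _; rewrite pavg_cst1 mulr1.
Qed.

(** The sum over q + 2 steps is split once after the first step and once before the last. *)
Lemma birk_period_shift q (psi : seqsp A -> R) z : iter q.+1 sigma z = z ->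
  birk q.+1 psi (sigma z) = birk q.+1 psi z.
Proof.
move=> qz; have := birkD 1 q.+1 psi z; rewrite addnC birkD qz /=.
by rewrite addrC => /addrI/esym.
Qed.

(** The weight of each word is spread evenly over the orbit of its periodic point. That [q] is
    chosen before [mu] matters: one finite set of periodic points carries all replicas. *)
Lemma periodic_replica Om k : subshift Om -> sofic Om ->
  exists q : nat, forall mu, inv_meas Om mu -> exists mu' : probability X R,
  [/\ inv_meas Om mu',
      forall psi, kdet Om k psi -> integ Om mu' psi = integ Om mu psi &
      forall B : set X, measurable B ->
        (forall z, Om z -> iter q.+1 sigma z = z -> B z) -> mu' B = 1%E].
Proof.
move=> sOm soOm; have [cOm _] := sOm.
have [q H] := periodic_marginals k sOm soOm.
exists q => mu imu; have [t [t0 tOm t1 Ht]] := H mu imu.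
pose I := ({ffun 'I_q.+1 -> A} * 'I_q.+1)%type.
pose c (i : I) := t i.1 / q.+1%:R.
pose pt (i : I) : X := iter i.2 sigma (per i.1).
have sumE (f : seqsp A -> R) : \sum_i c i * f (pt i) = \sum_w t w * pavg w f.
  under [RHS]eq_bigr do rewrite /pavg /birk mulrA mulrAC mulr_sumr.
  by rewrite (pair_bigA _ (fun w (j : 'I_q.+1) => t w / q.+1%:R * f (iter j sigma (per w)))).
have [||P HP] := @discrete_prob _ X R I c pt.
- by move=> i; rewrite divr_ge0.
- have := sumE (fun=> 1); under eq_bigr do rewrite mulr1.
  by move=> ->; rewrite -[RHS]t1; apply: eq_bigr => w _; rewrite pavg_cst1 mulr1.
have full (B : set X) : measurable B ->
    (forall z, Om z -> iter q.+1 sigma z = z -> B z) -> P B = 1%E.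
  move=> mB BOm; rewrite HP // (sumE (\1_B)) -[in RHS]t1; congr (_%:E).
  apply: eq_bigr => w _; have [Ow|/tOm->] := pselect (Om (per w)); last by rewrite mul0r.
  rewrite -[RHS]mulr1 -(pavg_cst1 w); congr (_ * (_ / _)); apply: eq_bigr => j _.
  rewrite indicE mem_set //; apply: BOm; first exact: subshift_iter.
  by rewrite -iterD addnC iterD iter_per.
have P1 : P Om = 1%E.
  by apply: full => //; exact: closed_measurable_seq.
exists P; split=> //.
- split=> // B mB.
  rewrite HP //; last exact: (@iter_shift_measurable A a0 1).
  rewrite HP // (sumE (\1_B)) (sumE (\1_(sigma @^-1` B))); congr (_%:E).
  apply: eq_bigr => w _; congr (_ * (_ / _)).
  by rewrite -[RHS]birk_period_shift ?iter_per //; apply: eq_bigr => j _; rewrite -iterSr.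
move=> psi kpsi; rewrite (integ_kdet cOm P1 kpsi) Ht // -sumE.
under eq_bigr => w _.
  rewrite /pr HP /=; last exact: wcyl_measurable.
  rewrite mulr_sumr; over.
rewrite exchange_big /=; apply: eq_bigr => i _.
have [Ow|/tOm t00] := pselect (Om (per i.1)); last first.
  by rewrite /c t00 !mul0r big1 // => w _; rewrite !mul0r mulr0.
rewrite (kdet_sum a0 kpsi) ?mulr_sumr; last exact: subshift_iter.
by apply: eq_bigr => w _; rewrite mulrCA.
Qed.

End PeriodicReplica.

(** * Approximation by clopen partitions *)

Section ClopenApproximation.
Variables (A : finType) (a0 : A) (R : realType).
Local Notation X := (g_sigma_algebraType (@borel_open A a0)).
Local Notation sigma := (@Defs.shift A).
Variable mu : probability X R.
Implicit Types (x y z : seqsp A) (B C : set X).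

Definition det m (C : set (seqsp A)) := forall x y, cyl x m y -> C x -> C y.

Definition symdiff B C : set X := (B `\` C) `|` (C `\` B).

Lemma symdiff_measurable B C : measurable B -> measurable C -> measurable (symdiff B C).
Proof. by move=> mB mC; apply: measurableU; apply: measurableD. Qed.

Definition approximable B :=
  measurable B /\ forall e : R, 0 < e -> exists m C, det m C /\ pr mu (symdiff B C) < e.

Lemma pr_le_sum (I : finType) B (E : I -> set X) : measurable B ->
  (forall i, measurable (E i)) -> (forall x, B x -> exists i, E i x) ->
  pr mu B <= \sum_i pr mu (E i).
Proof.
move=> mB mE BE.
have -> : pr mu B = \sum_(u : unit) 1 * pr mu B by rewrite sumr_const card_unit mulr1n mul1r.
have -> : \sum_i pr mu (E i) = \sum_i 1 * pr mu (E i) by apply: eq_bigr => i _; rewrite mul1r.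
apply: (@indic_comb_le _ X R mu unit I (fun=> 1) (fun=> B)) => // x.
rewrite sumr_const card_unit mulr1n mul1r indicE.
case: (boolP (x \in B)) => [/set_mem/BE[i Ei]|_]; last first.
  by apply: sumr_ge0 => i _; rewrite mul1r.
rewrite (bigD1 i) //= mul1r [X in _ <= X + _]indicE mem_set // lerDl.
by apply: sumr_ge0 => j _; rewrite mul1r.
Qed.

Lemma pr_setU_le B C : measurable B -> measurable C -> pr mu (B `|` C) <= pr mu B + pr mu C.
Proof.
move=> mB mC; have mBC : measurable (B `|` C) by exact: measurableU.
rewrite -lee_fin EFinD -!prE //.
exact: measureU2.
Qed.

Lemma approximableU B1 B2 : approximable B1 -> approximable B2 -> approximable (B1 `|` B2).
Proof.
move=> [mB1 H1] [mB2 H2]; split=> [|e e0]; first exact: measurableU.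
have e2 : 0 < e / 2 by rewrite divr_gt0.
have [m1 [C1 [d1 h1]]] := H1 _ e2; have [m2 [C2 [d2 h2]]] := H2 _ e2.
exists (maxn m1 m2), (C1 `|` C2); split.
  move=> x y xy [c1|c2]; [left; apply: d1 c1|right; apply: d2 c2].
    exact: cyl_le (leq_maxl _ _) xy.
  exact: cyl_le (leq_maxr _ _) xy.
have mC1 := @det_measurable A a0 _ _ d1; have mC2 := @det_measurable A a0 _ _ d2.
have mS1 := symdiff_measurable mB1 mC1; have mS2 := symdiff_measurable mB2 mC2.
apply: (@le_lt_trans _ _ (pr mu (symdiff B1 C1 `|` symdiff B2 C2))).
  apply: le_pr; [|exact: measurableU|].
    by apply: symdiff_measurable; exact: measurableU.
  move=> x [[[b1|b2] /not_orP[n1 n2]]|[[c1|c2] /not_orP[n1 n2]]].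
  - by left; left.
  - by right; left.
  - by left; right.
  - by right; right.
by apply: le_lt_trans (pr_setU_le mS1 mS2) _; lra.
Qed.

(** By continuity from below some [F n] misses less than e/2 of the union; it is then approximated
    within e/2. *)
Lemma approximable_bigcup_nondecreasing (F : nat -> set X) :
  (forall n m, (n <= m)%N -> F n `<=` F m) -> (forall n, approximable (F n)) ->
  approximable (\bigcup_n F n).
Proof.
move=> ndF aF; have mF n : measurable (F n) by have [] := aF n.
have mU : measurable (\bigcup_n F n) by exact: bigcup_measurable.
split=> // e e0; have e2 : 0 < e / 2 by rewrite divr_gt0.
have [n Hn] : exists n, pr mu (\bigcup_n F n) - e / 2 < pr mu (F n).
  apply: contrapT => /forallNP H.
  have cvF : (mu \o F) n @[n --> \oo] --> mu (\bigcup_n F n).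
    by apply: nondecreasing_cvg_mu => // n m nm; apply/subsetPset; exact: ndF.
  have : (mu (\bigcup_n F n) <= (pr mu (\bigcup_n F n) - e / 2)%:E)%E.
    rewrite -(cvg_lim _ cvF) //; apply: lime_le; first by apply/cvg_ex; exists (mu (\bigcup_n F n)).
    apply: nearW => n /=; rewrite prE // lee_fin leNgt; apply/negP; exact: H.
  by rewrite prE // lee_fin; lra.
have [_ /(_ _ e2)[m [C [dC hC]]]] := aF n.
exists m, C; split=> //; have mC := @det_measurable A a0 _ _ dC.
have mS := symdiff_measurable (mF n) mC.
have mD : measurable (\bigcup_n F n `\` F n) by exact: measurableD.
have hD : pr mu (\bigcup_n F n) = pr mu (F n) + pr mu (\bigcup_n F n `\` F n).
  apply: EFin_inj; rewrite EFinD -!prE // -measureU //.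
    congr (mu _); apply/seteqP; split=> [x Ux|x [Fx|[]//]]; last by exists n.
    by have [Fx|nFx] := pselect (F n x); [left|right].
  by apply/seteqP; split=> // x [Fx []].
apply: (@le_lt_trans _ _ (pr mu (symdiff (F n) C `|` (\bigcup_n F n `\` F n)))).
  apply: le_pr; [exact: symdiff_measurable|exact: measurableU|].
  move=> x [[[i _ Fi] nC]|[Cx nF]].
    have [Fn|nFn] := pselect (F n x); first by left; left.
    by right; split=> //; exists i.
  by left; right; split=> // Fn; apply: nF; exists n.
by apply: le_lt_trans (pr_setU_le mS mD) _; lra.
Qed.

Lemma approximable_det m C : det m C -> approximable C.
Proof.
move=> dC; split; first exact: det_measurable dC.
move=> e e0; exists m, C; split=> //.
by rewrite /symdiff setDv setU0 /pr measure0.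
Qed.

(** Approximable sets form a sigma-algebra. It contains each open set, the increasing union over n
    of the n-cylinders inside it. *)
Lemma measurable_approximable B : measurable B -> approximable B.
Proof.
have : <<s @borel_open A a0 >> `<=` approximable; last exact.
apply: smallest_sub; last first.
  move=> U oU; pose F n : set X := [set x | cyl x n `<=` U].
  rewrite (_ : U = \bigcup_n F n); last first.
    apply/seteqP; split=> [x /oU[n sub]|x [n _]]; first by exists n.
    exact.
  apply: approximable_bigcup_nondecreasing => [n m nm x Fx y xy|n].
    by apply: Fx; exact: cyl_le xy.
  apply: (@approximable_det n) => x y xy Fx z yz; apply: Fx.
  exact: cyl_trans xy yz.
split.
- exact: (@approximable_det 0).
- move=> B' [mB H]; rewrite setTD; split=> [|e e0]; first exact: measurableC.
  have [m [C [dC hC]]] := H e e0; exists m, (~` C); split.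
    by move=> x y xy nC Cy; apply: nC; apply: dC Cy; exact: cyl_sym.
  rewrite (_ : symdiff _ _ = symdiff B' C) //.
  by rewrite /symdiff !setDE !setCK setUC; congr (_ `|` _); rewrite setIC.
- move=> F aF; pose G n : set X := [set x | exists2 i, (i <= n)%N & F i x].
  rewrite (_ : \bigcup_n F n = \bigcup_n G n); last first.
    apply/seteqP; split=> x [n _]; first by move=> Fx; exists n => //; exists n.
    by move=> [i _ Fx]; exists i.
  apply: approximable_bigcup_nondecreasing => [n m nm x [i im Fx]|].
    by exists i => //; exact: leq_trans nm.
  elim=> [|n IH].
    rewrite (_ : G 0%N = F 0%N) //; apply/seteqP; split=> x; last by exists 0%N.
    by move=> [i]; rewrite leqn0 => /eqP->.
  rewrite (_ : G n.+1 = G n `|` F n.+1); first exact: approximableU.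
  apply/seteqP; split=> x; last by move=> [[i im Fx]|Fx]; [exists i => //; exact: leqW|exists n.+1].
  by move=> [i]; rewrite leq_eqVlt => /orP[/eqP->|im]; [right|left; exists i].
Qed.

Lemma partition_approx s (nm : seqsp A -> 'I_s) (e : R) : 0 < e ->
  (forall i, measurable ([set x | nm x = i] : set X)) ->
  exists m (c : seqsp A -> 'I_s), [/\ forall x y, cyl x m y -> c x = c y,
    measurable ([set x | nm x <> c x] : set X) &
    pr mu [set x | nm x <> c x] <= e].
Proof.
move=> e0 mnm; have s0 : (0 < s)%N by case: s nm mnm => // nm; have [] := nm (fun=> a0).
have es : 0 < e / s%:R by rewrite divr_gt0 // ltr0n.
have ap i := (measurable_approximable (mnm i)).2 _ es.
have [m Hm] := choice ap; have [C HC] := choice Hm.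
(* The default is harmless: a point in no [C i] lies in the symmetric difference attached to its own
   name, and so is already counted as an error. *)
pose c x : 'I_s := odflt (nm (fun=> a0)) [pick i | `[< C i x >]].
have cdet x y : cyl x (\max_i m i) y -> c x = c y.
  move=> xy; rewrite /c; congr odflt; apply: eq_pick => i /=.
  have [dC _] := HC i; have xyi : cyl x (m i) y by apply: cyl_le xy; exact: leq_bigmax.
  by apply/asboolP/asboolP; apply: dC => //; exact: cyl_sym.
have mC i : measurable (C i) by have [dC _] := HC i; exact: det_measurable dC.
have mD : measurable ([set x | nm x <> c x] : set X).
  rewrite (_ : [set x | _] =
      \bigcup_(i in [set: 'I_s]) ([set x | nm x = i] `&` [set x | c x <> i])).
    apply: fin_bigcup_measurable; first exact: finite_finset.
    move=> i _; apply: measurableI; first exact: mnm.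
    by apply: (@det_measurable A a0 (\max_i m i)) => x y /cdet xy /=; rewrite xy.
  apply/seteqP; split=> [x /= nc|x [i _ [/= <- nc]]]; last by move=> /esym.
  by exists (nm x) => //; split=> // /esym.
exists (\max_i m i), c; split => //.
apply: (@le_trans _ _ (\sum_i pr mu (symdiff [set x | nm x = i] (C i)))).
  apply: pr_le_sum => // [i|x /= nc]; first exact: symdiff_measurable.
  have [Cx|nCx] := pselect (C (nm x) x); last by exists (nm x); left.
  move: nc; rewrite /c; case: pickP => [j /asboolP Cj /= nj|/(_ (nm x))/asboolP//].
  by exists j; right.
apply: (@le_trans _ _ (\sum_(i < s) e / s%:R)).
  by apply: ler_sum => i _; have [_ /ltW] := HC i.
by rewrite sumr_const card_ord -(mulr_natr (e / s%:R) s) divfK // pnatr_eq0 -lt0n.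
Qed.

End ClopenApproximation.

(** * Entropy bounds *)

Section Gibbs.
Variable R : realType.

Lemma ln_le_sub1 (x : R) : 0 < x -> ln x <= x - 1.
Proof. by move=> x0; rewrite -{1}(subrKC 1 x); apply: le_ln1Dx; lra. Qed.

(** Termwise the difference is at least [p i - q i], by the tangent bound for [ln] at 1. *)
Lemma gibbs (I : finType) (p q : I -> R) : (forall i, 0 <= p i) -> (forall i, 0 < q i) ->
  \sum_i q i <= \sum_i p i -> \sum_i Defs.eta (p i) <= \sum_i p i * - ln (q i).
Proof.
move=> p0 q0 qp; rewrite -subr_ge0 -sumrB.
apply: (@le_trans _ _ (\sum_i (p i - q i))); first by rewrite sumrB subr_ge0.
apply: ler_sum => i _; rewrite /Defs.eta opprK.
have [pi0|pi0] := eqVneq (p i) 0; first by rewrite pi0 !mul0r addr0 sub0r oppr_le0 ltW.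
have pp : 0 < p i by rewrite lt_neqAle eq_sym pi0 p0.
have := ln_le_sub1 (divr_gt0 (q0 i) pp); rewrite ln_div ?posrE //.
move=> /(ler_wpM2l (p0 i)).
have -> : p i * (q i / p i - 1) = q i - p i by field.
by move: (ln _) (ln _) => lq lp; lra.
Qed.

Lemma ln_prod (I : finType) (F : I -> R) : (forall i, 0 < F i) ->
  0 < \prod_i F i /\ ln (\prod_i F i) = \sum_i ln (F i).
Proof.
move=> F0; elim/big_rec2: _ => [|i y x _ [y0 <-]]; first by rewrite ln1.
by split; [rewrite mulr_gt0|rewrite lnM ?posrE].
Qed.

Lemma eta_ge0 (t : R) : 0 <= t <= 1 -> 0 <= Defs.eta t.
Proof.
move=> /andP[t0 t1]; rewrite /Defs.eta -mulrN mulr_ge0 // oppr_ge0.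
exact: ln_le0.
Qed.

End Gibbs.

Section Entropy.
Variables (A : finType) (a0 : A) (R : realType).
Local Notation X := (g_sigma_algebraType (@borel_open A a0)).
Local Notation sigma := (@Defs.shift A).
Implicit Types (x y z : seqsp A).
Variables (Om : set (seqsp A)) (mu : probability X R) (imu : inv_meas Om mu).

Section Bound.
Variables (xi : seq (set X)) (nm : seqsp A -> 'I_(size xi)).
Hypothesis mxi : forall i, (i < size xi)%N -> measurable (nth set0 xi i).
Hypothesis nmP : forall x (i : 'I_(size xi)), nth set0 xi i x <-> nm x = i.
Local Notation s := (size xi).
Variables (m : nat) (c : seqsp A -> 'I_s).
Hypothesis cdet : forall x y, cyl x m y -> c x = c y.
Hypothesis mD : measurable ([set x | nm x <> c x] : set X).
Variables (N : nat) (W : {set {ffun 'I_N.+1 -> A}}).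
Hypothesis W0 : (0 < #|W|)%N.
Variable dl : R.
Hypothesis dl01 : 0 < dl < 1.
Variables (n b : nat).
Hypothesis nb : (n + m <= b * N.+1)%N.

Let K : R := #|{ffun 'I_N.+1 -> A}|%:R.
Let QN (w : {ffun 'I_N.+1 -> A}) : R := (w \in W)%:R / (2 * #|W|%:R) + 1 / (2 * K).
Let kap (i j : 'I_s) : R := (1 - dl) * (i == j)%:R + dl / s%:R.

(* Words are coded by their consecutive blocks of length N+1: [QN] favours the
   blocks in W, and [kap] lets the name of a point deviate from its clopen
   approximation [c] with small probability. *)
Let dec (a : {ffun 'I_b -> {ffun 'I_N.+1 -> A}}) : seqsp A :=
  fun l => if insub (l %/ N.+1)%N is Some i then a i (inord (l %% N.+1)%N) else a0.
Let qa (a : {ffun 'I_b -> {ffun 'I_N.+1 -> A}}) (u : {ffun 'I_n -> 'I_s}) : R :=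
  \prod_i QN (a i) * \prod_j kap (u j) (c (iter j sigma (dec a))).
Let q u : R := \sum_a qa a u.

Let s0 : (0 < s)%N. Proof. by have := ltn_ord (nm (fun=> a0)); apply: leq_ltn_trans. Qed.
Let K0 : 0 < K.
Proof. by rewrite ltr0n; apply/card_gt0P; exists [ffun=> a0]. Qed.
Let Wr : 0 < #|W|%:R :> R. Proof. by rewrite ltr0n. Qed.

Let QN_gt0 w : 0 < QN w.
Proof.
apply: ltr_wpDl; first by rewrite divr_ge0 // mulr_ge0 // ltW.
by rewrite divr_gt0 // mulr_gt0.
Qed.

Let kap_gt0 i j : 0 < kap i j.
Proof.
case/andP: dl01 => d0 d1.
apply: ltr_wpDl; first by rewrite mulr_ge0 // subr_ge0 ltW.
by rewrite divr_gt0 // ltr0n.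
Qed.

Let sum_QN : \sum_w QN w = 1.
Proof.
rewrite big_split /= -mulr_suml -natr_sum -big_mkcond /= sum1_card sumr_const.
rewrite -(mulr_natr (1 / (2 * K))) -/K.
have : K != 0 by rewrite gt_eqF.
have : #|W|%:R != 0 :> R by rewrite gt_eqF.
by move=> *; field; apply/andP.
Qed.

Let sum_kap j : \sum_i kap i j = 1.
Proof.
rewrite big_split /= -mulr_sumr (bigD1 j) //= eqxx big1 ?addr0; last first.
  by move=> i /negPf->.
rewrite sumr_const card_ord -(mulr_natr (dl / s%:R)) divfK ?mulr1 ?subrK //.
by rewrite pnatr_eq0 -lt0n.
Qed.

Let sum_q : \sum_u q u = 1.
Proof.
rewrite exchange_big /=.
rewrite (eq_bigr (fun a : {ffun 'I_b -> {ffun 'I_N.+1 -> A}} => \prod_i QN (a i))).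
  rewrite -(bigA_distr_bigA (fun (i : 'I_b) w => QN w)) /=.
  by rewrite big1 // => i _; exact: sum_QN.
move=> a _; rewrite -mulr_sumr.
rewrite -(bigA_distr_bigA (fun (j : 'I_n) i => kap i (c (iter j sigma (dec a))))) /=.
by rewrite [X in _ * X]big1 ?mulr1 // => j _; exact: sum_kap.
Qed.

Let qa_gt0 a u : 0 < qa a u.
Proof. by rewrite mulr_gt0 // prodr_gt0. Qed.

Let q_ge a u : qa a u <= q u.
Proof. by rewrite /q (bigD1 a) //= lerDl sumr_ge0 // => a' _; exact: ltW. Qed.

Let q_gt0 u : 0 < q u.
Proof. exact: lt_le_trans (qa_gt0 [ffun=> [ffun=> a0]] u) (q_ge _ u). Qed.

Let ux x : {ffun 'I_n -> 'I_s} := [ffun j : 'I_n => nm (iter j sigma x)].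
Let ax x : {ffun 'I_b -> {ffun 'I_N.+1 -> A}} :=
  [ffun i : 'I_b => word N.+1 (iter (i * N.+1) sigma x)].

(** By [nb] the blocks cover n + m letters, hence every window of length m that starts before time
    n. *)
Let c_dec x (j : 'I_n) : c (iter j sigma (dec (ax x))) = c (iter j sigma x).
Proof.
apply: cdet => t tm; rewrite !iter_shift /dec.
have lt : ((t + j) %/ N.+1 < b)%N.
  by rewrite ltn_divLR //; apply: leq_trans nb; have := ltn_ord j; lia.
rewrite insubT /= !ffunE iter_shift inordK ?ltn_pmod //.
by congr x; rewrite [LHS](divn_eq (t + j) N.+1) addnC.
Qed.

Let V : set X := [set x | word N.+1 x \notin W].
Let D : set X := [set x | nm x <> c x].

(** Each half of the mixture [QN] bounds the cost: the uniform law on [W] for a block in [W], the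
    uniform law on all words otherwise. *)
Let lnQN x : - ln (QN (word N.+1 x)) <= ln (2 * #|W|%:R) + ln (2 * K) * \1_V x.
Proof.
have K1 : 1 <= K by rewrite ler1n -(ltr0n R).
have W1 : 1 <= #|W|%:R :> R by rewrite ler1n.
rewrite indicE; case: (boolP (word N.+1 x \in W)) => wW.
  rewrite memNset; last by rewrite /V /= wW.
  rewrite mulr0 addr0 -lnV ?posrE // ler_ln ?posrE ?invr_gt0 ?mulr_gt0 //.
  rewrite -[leRHS]invrK lef_pV2 ?posrE ?invr_gt0 ?mulr_gt0 // /QN wW.
  by rewrite /= mulr1n !div1r lerDl invr_ge0 mulr_ge0 // ltW.
rewrite mem_set // mulr1 -lnV ?posrE //.
rewrite -[leLHS]add0r lerD //; first by apply: ln_ge0; lra.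
rewrite ler_ln ?posrE ?invr_gt0 ?mulr_gt0 //.
rewrite -[leRHS]invrK lef_pV2 ?posrE ?invr_gt0 ?mulr_gt0 // /QN.
by rewrite (negPf wW) mul0r add0r div1r.
Qed.

Let lnkap x : - ln (kap (nm x) (c x)) <= - ln (1 - dl) + ln (s%:R / dl) * \1_D x.
Proof.
case/andP: dl01 => d0 d1; have sR : 0 < s%:R :> R by rewrite ltr0n.
have s1 : 1 <= s%:R :> R by rewrite ler1n.
have dl1 : 0 < 1 - dl by rewrite subr_gt0.
rewrite indicE; case: (eqVneq (nm x) (c x)) => nc.
  rewrite memNset; last by rewrite /D /= => /(_ nc).
  rewrite mulr0 addr0 lerN2 ler_ln ?posrE // /kap nc eqxx mulr1 lerDl.
  by rewrite divr_ge0 // ltW.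
rewrite mem_set; last exact/eqP.
rewrite mulr1 -[leLHS]add0r lerD //.
  by rewrite oppr_ge0; apply: ln_le0; lra.
rewrite -lnV ?posrE // ler_ln ?posrE ?invr_gt0 ?divr_gt0 //.
rewrite -[leRHS]invrK lef_pV2 ?posrE ?invr_gt0 ?divr_gt0 //.
by rewrite invf_div /kap (negPf nc) mulr0 add0r.
Qed.

Let Bu (u : {ffun 'I_n -> 'I_s}) : set X :=
  [set x | forall i : 'I_n, nth set0 xi (u i) (iter i sigma x)].

Let BuE u x : Bu u x <-> ux x = u.
Proof.
split=> [H|<- i]; last by rewrite ffunE; apply/nmP.
by apply/ffunP => i; rewrite ffunE; apply/nmP.
Qed.

Let mBu u : measurable (Bu u).
Proof. exact: itinerary_measurable. Qed.

Let mV : measurable V.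
Proof.
apply: (@det_measurable A a0 N.+1) => x y xy; rewrite /V /=.
suff -> : word N.+1 x = word N.+1 y by [].
by apply/ffunP => j; rewrite !ffunE xy.
Qed.

Let sum_Bu x (g : {ffun 'I_n -> 'I_s} -> R) : \sum_u g u * \1_(Bu u) x = g (ux x).
Proof.
rewrite (bigD1 (ux x)) //= indicE mem_set; last exact/BuE.
rewrite mulr1 big1 ?addr0 // => u /eqP un.
by rewrite indicE memNset ?mulr0 // => /BuE/esym.
Qed.

(** Gibbs' inequality against [q], where [q] is bounded below by its summand at the true blocks of
    the point. The logarithm of that product is a sum of block and correction costs, integrated by
    invariance. *)
Lemma join_entropy_bound : join_entropy mu xi n <=
  b%:R * (ln (2 * #|W|%:R) + ln (2 * K) * pr mu V) +
  n%:R * (- ln (1 - dl) + ln (s%:R / dl) * pr mu D).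
Proof.
have prBu : \sum_u q u <= \sum_u pr mu (Bu u).
  rewrite sum_q -(prT mu).
  have -> : pr mu setT = \sum_(i : unit) 1 * pr mu setT by rewrite sumr_const card_unit mul1r.
  have -> : \sum_u pr mu (Bu u) = \sum_u 1 * pr mu (Bu u) by apply: eq_bigr => u _; rewrite mul1r.
  apply: (@indic_comb_le _ X R mu unit _ (fun=> 1) (fun=> setT)) => // x.
  by rewrite (sum_Bu x (fun=> 1)) sumr_const card_unit indicT mulr1.
apply: le_trans (gibbs (fun u => pr_ge0 mu (Bu u)) q_gt0 prBu) _.
(* One index for the constant costs, one for each block and one for each letter. *)
pose J := (unit + ('I_b + 'I_n))%type.
pose cJ (j : J) : R := match j with
  | inl _ => b%:R * ln (2 * #|W|%:R) + n%:R * - ln (1 - dl)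
  | inr (inl _) => ln (2 * K) | inr (inr _) => ln (s%:R / dl) end.
pose BJ (j : J) : set X := match j with inl _ => setT
  | inr (inl i) => iter (i * N.+1) sigma @^-1` V | inr (inr i) => iter i sigma @^-1` D end.
have mBJ j : measurable (BJ j).
  case: j => [_|[i|i]] /=; [exact: measurableT|exact: iter_shift_measurable|].
  exact: iter_shift_measurable.
have -> : \sum_u pr mu (Bu u) * - ln (q u) = \sum_u (- ln (q u)) * pr mu (Bu u).
  by apply: eq_bigr => u _; rewrite mulrC.
apply: (@le_trans _ _ (\sum_j cJ j * pr mu (BJ j))).
  apply: indic_comb_le => // x.
  rewrite (sum_Bu x (fun u => - ln (q u))).
  apply: (@le_trans _ _ (- ln (qa (ax x) (ux x)))).
    by rewrite lerN2 ler_ln ?posrE.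
  rewrite !big_sumType /= sumr_const card_unit mulr1n indicT mulr1.
  have [P1 E1] := ln_prod (fun i => QN_gt0 (ax x i)).
  have [P2 E2] := ln_prod (fun j : 'I_n => kap_gt0 (ux x j) (c (iter j sigma (dec (ax x))))).
  have -> : ln (qa (ax x) (ux x)) = \sum_i ln (QN (ax x i)) +
      \sum_j ln (kap (ux x j) (c (iter j sigma (dec (ax x))))).
    by rewrite /qa lnM ?posrE // E1 E2.
  rewrite opprD -!sumrN.
  have h1 : \sum_(i < b) - ln (QN (ax x i)) <=
      \sum_(i < b) (ln (2 * #|W|%:R) + ln (2 * K) * \1_(iter (i * N.+1) sigma @^-1` V) x).
    by apply: ler_sum => i _; rewrite ffunE; exact: lnQN.
  have h2 : \sum_(j < n) - ln (kap (ux x j) (c (iter j sigma (dec (ax x))))) <=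
      \sum_(j < n) (- ln (1 - dl) + ln (s%:R / dl) * \1_(iter j sigma @^-1` D) x).
    by apply: ler_sum => j _; rewrite c_dec ffunE; exact: lnkap.
  apply: le_trans (lerD h1 h2) _.
  rewrite !big_split /= !sumr_const !card_ord -!(mulr_natl (ln _)) -(mulr_natl (- ln _)).
  by rewrite le_eqVlt; apply/orP; left; apply/eqP; ring.
rewrite !big_sumType /= sumr_const card_unit mulr1n prT mulr1.
have e1 (i : 'I_b) : pr mu (iter (i * N.+1) sigma @^-1` V) = pr mu V.
  by congr fine; exact: (inv_meas_iter _ imu).
have e2 (i : 'I_n) : pr mu (iter i sigma @^-1` D) = pr mu D.
  by congr fine; exact: (inv_meas_iter _ imu).
under eq_bigr do rewrite e1.
under [X in _ + (_ + X)]eq_bigr do rewrite e2.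
rewrite !sumr_const !card_ord -(mulr_natl (ln (2 * K) * _)) -(mulr_natl (ln (s%:R / dl) * _)).
by rewrite le_eqVlt; apply/orP; left; apply/eqP; ring.
Qed.

End Bound.
End Entropy.

(** * Generic functions *)

Section ZeroEntropy.
Variables (A : finType) (a0 : A) (R : realType).
Local Notation X := (g_sigma_algebraType (@borel_open A a0)).
Local Notation sigma := (@Defs.shift A).
Implicit Types (Om : set (seqsp A)) (x y z : seqsp A) (mu : probability X R).

(** Up to a small mass, the words at one scale grow at a small exponential rate. The factor 2 is
    that of the block cost in [join_entropy_bound]. *)
Definition low_complexity n mu := exists N (W : {set {ffun 'I_N.+1 -> A}}),
  [/\ (0 < #|W|)%N, ln (2 * #|W|%:R) <= N.+1%:R / n.+1%:R :> R &
      pr mu [set x | word N.+1 x \notin W] <= n.+1%:R^-1].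

Lemma join_entropy_ge0 mu (xi : seq (set X)) n : meas_partition xi ->
  0 <= join_entropy mu xi n.
Proof.
move=> [mxi _]; apply: sumr_ge0 => u _; apply: eta_ge0.
have mB := itinerary_measurable u mxi.
rewrite -/(pr mu _) pr_ge0 /= -(prT mu); exact: le_pr.
Qed.

Lemma partition_names (xi : seq (set X)) : meas_partition xi ->
  exists nm : seqsp A -> 'I_(size xi),
  forall x (i : 'I_(size xi)), nth set0 xi i x <-> nm x = i.
Proof.
move=> [mxi [dis cov]].
have /choice[nm Hnm] (x : seqsp A) : exists i : 'I_(size xi), nth set0 xi i x.
  have : (\bigcup_(i in [set i | (i < size xi)%N]) nth set0 xi i) x by rewrite cov.
  by move=> [i /= lt xx]; exists (Ordinal lt).
exists nm => x i; split=> [xix|<-//]; apply: contrapT => ni.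
have : (nth set0 xi (nm x) `&` nth set0 xi i) x by split.
by rewrite dis // => /val_inj.
Qed.

(** Per letter, the blocks, the uncorrected names and the corrections cost at most e/4 each. *)
Lemma join_entropy_rate_le Om mu (xi : seq (set X)) (e : R) : inv_meas Om mu ->
  (forall n, low_complexity n mu) -> meas_partition xi -> 0 < e ->
  exists n0, forall n, (n0 <= n)%N -> join_entropy mu xi n.+1 / n.+1%:R <= e.
Proof.
move=> imu lc pxi e0; have [mxi _] := pxi.
have [nm nmP] := partition_names pxi.
have mnm i : measurable ([set x | nm x = i] : set X).
  rewrite (_ : [set x | _] = nth set0 xi i); first exact: mxi.
  by apply/seteqP; split=> x /=; [move=> /nmP|move=> h; apply/nmP].
pose dl : R := 1 - expR (- (e / 4)).
have dl01 : 0 < dl < 1.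
  by rewrite /dl subr_gt0 expR_lt1 oppr_lt0 divr_gt0 //= gtrBl expR_gt0.
have lndl : - ln (1 - dl) = e / 4 by rewrite /dl subKr expRK opprK.
pose ls : R := ln ((size xi)%:R / dl).
(* The error allowed to the clopen approximation, chosen after [dl] so that corrections cost at most
   e/4. *)
pose rho : R := e / (4 * (`|ls| + 1)).
have ls1 : 0 < 4 * (`|ls| + 1) by rewrite mulr_gt0 // ltr_pwDr.
have rho0 : 0 < rho by rewrite divr_gt0.
have [m [c [cdet mD prD]]] := partition_approx mu rho0 mnm.
(* The 1 accounts for words in [W]; the logarithms bound the cost per letter of an arbitrary
   block. *)
pose T : R := 1 + ln 2 + ln #|A|%:R.
have A1 : 1 <= #|A|%:R :> R by rewrite ler1n; apply/card_gt0P; exists a0.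
have lnA : 0 <= ln #|A|%:R :> R by exact: ln_ge0.
have ln2 : 0 <= ln 2 :> R by apply: ln_ge0; lra.
have T0 : 0 < T by rewrite /T; lra.
have [N [W [W0 lnW prV]]] := lc (Num.truncn (8 * T / e)).
set n1 := (Num.truncn _).+1%:R in lnW prV.
have n1T : T / n1 <= e / 8.
  have : 8 * T / e < n1 by exact: truncnS_gt.
  have n1_gt0 : 0 < n1 by rewrite ltr0n.
  by rewrite ltr_pdivrMr // ler_pdivrMr //; lra.
exists (m + N.+1)%N => n hn.
pose b := ((n.+1 + m) %/ N.+1).+1%N.
have nb : (n.+1 + m <= b * N.+1)%N by rewrite ltnW // ltn_ceil.
have bn : (b * N.+1 <= 2 * n.+1)%N.
  by rewrite /b mulSn; have := leq_trunc_div (n.+1 + m) N.+1; lia.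
rewrite ler_pdivrMr ?ltr0Sn //.
apply: le_trans (join_entropy_bound imu mxi nmP cdet mD W0 dl01 nb) _.
rewrite lndl -/ls.
set V := [set x | word N.+1 x \notin W] in prV *.
set D := [set x | _].
have hD : ls * pr mu D <= e / 4.
  apply: (@le_trans _ _ (`|ls| * rho)).
    apply: le_trans (ler_wpM2r (pr_ge0 _ _) (ler_norm ls)) _.
    exact: ler_wpM2l.
  rewrite /rho mulrA ler_pdivrMr //.
  by have := normr_ge0 ls; move: `|ls| => l l0; lra.
have hV : ln (2 * #|W|%:R) + ln (2 * #|{ffun 'I_N.+1 -> A}|%:R) * pr mu V <= N.+1%:R * (e / 8).
  have -> : ln (2 * #|{ffun 'I_N.+1 -> A}|%:R) = ln 2 + N.+1%:R * ln #|A|%:R :> R.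
    have A0 : 0 < #|A|%:R :> R by apply: lt_le_trans A1.
    rewrite card_ffun card_ord natrX lnM ?posrE ?exprn_gt0 //.
    by rewrite lnXn // -(mulr_natl (ln #|A|%:R)).
  have NR : 1 <= N.+1%:R :> R by rewrite ler1n.
  have NR0 : 0 <= N.+1%:R :> R by [].
  apply: (@le_trans _ _ (N.+1%:R * (T / n1))); last exact: ler_wpM2l.
  have -> : N.+1%:R * (T / n1) = N.+1%:R / n1 + N.+1%:R * (ln 2 + ln #|A|%:R) / n1.
    by rewrite /T; ring.
  apply: lerD => //; apply: ler_pM => //; [|exact: pr_ge0|].
    by rewrite addr_ge0 // mulr_ge0.
  by rewrite mulrDr lerD2r ler_peMl.
have b0 : 0 <= b%:R :> R by [].
have h1 := ler_wpM2l b0 hV.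
have h2 : b%:R * (N.+1%:R * (e / 8)) <= n.+1%:R * (e / 4).
  rewrite mulrA -natrM; apply: (@le_trans _ _ ((2 * n.+1)%:R * (e / 8))).
    by rewrite ler_wpM2r ?ler_nat // divr_ge0 // ltW.
  by rewrite natrM; move: (n.+1%:R) => nn; lra.
have h3 : n.+1%:R * (e / 4 + ls * pr mu D) <= n.+1%:R * (e / 2).
  by rewrite ler_wpM2l //; lra.
apply: le_trans (lerD (le_trans h1 h2) h3) _.
have : 0 <= n.+1%:R * e by rewrite mulr_ge0 // ltW.
by move: (n.+1%:R) => nn; lra.
Qed.

Lemma ks_entropy_eq0 Om mu : inv_meas Om mu ->
  (forall n, low_complexity n mu) -> ks_entropy mu = 0%E.
Proof.
move=> imu lc.
have pe0 (xi : seq (set X)) : meas_partition xi -> part_entropy mu xi = 0.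
  move=> pxi; apply/cvg_lim => //; apply/cvgrPdist_le => e e0.
  have [n0 Hn0] := join_entropy_rate_le imu lc pxi e0.
  exists n0 => // n n0n; rewrite /= sub0r normrN ger0_norm; first exact: Hn0.
  by rewrite divr_ge0 // join_entropy_ge0.
rewrite /ks_entropy (_ : [set _ | _ in _] = [set 0%E]) ?ereal_sup1 //.
apply/seteqP; split=> [_ [xi pxi <-]|_ ->]; first by rewrite /= pe0.
have pT : meas_partition ([:: setT] : seq (set X)).
  split; first by case=> [_|//]; exact: measurableT.
  split; first by case=> [|i] [|j].
  by apply/seteqP; split=> // x _; exists 0%N.
by exists [:: setT]; rewrite ?pe0.
Qed.

End ZeroEntropy.

Section Generic.
Variables (A : finType) (a0 : A) (R : realType).
Local Notation X := (g_sigma_algebraType (@borel_open A a0)).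
Local Notation sigma := (@Defs.shift A).
Implicit Types (Om : set (seqsp A)) (x y z : seqsp A) (mu : probability X R).

Lemma integ_indic Om mu (V : set X) : prod_closed Om -> mu Om = 1%E ->
  measurable V -> integ Om mu (\1_V) = pr mu V.
Proof.
move=> cOm Om1 mV; have mOm := closed_measurable_seq (a0 := a0) cOm.
rewrite /integ integral_indic //; congr fine; exact: pr_full_setI.
Qed.

Lemma integ_kdetB Om mu k (c : R) f g : prod_closed Om -> mu Om = 1%E ->
  kdet Om k f -> kdet Om k g ->
  integ Om mu (fun x => f x - c * g x) = integ Om mu f - c * integ Om mu g.
Proof.
move=> cOm Om1 kf kg.
have kfg : kdet Om k (fun x => f x - c * g x).
  by move=> x y Ox Oy xy; rewrite (kf x y) // (kg x y).
rewrite (integ_kdet cOm Om1 kfg) (integ_kdet cOm Om1 kf) (integ_kdet cOm Om1 kg).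
by rewrite mulr_sumr -sumrB; apply: eq_bigr => w _; rewrite mulrBl mulrA.
Qed.

Lemma integ_le_beta Om d (phi : 'I_d -> seqsp A -> rat) (h : 'rV[R]_d) f mu :
  prod_closed Om -> cont_on Om f -> inv_meas Om mu -> rv Om phi mu = h ->
  integ Om mu f <= beta a0 Om phi h f.
Proof.
move=> cOm cf imu rmu; apply: sup_upper_bound; last by exists mu.
split; first by exists (integ Om mu f), mu.
have [N HN] := cont_on_bounded cOm cf.
exists N%:R => _ [nu [[Om1 _] _] <-].
have c0 : cont_on Om (fun=> 0 : R) by exact: (@kdet_cont A R Om 0).
have := @integ_dist_le A a0 R Om nu f (fun=> 0) N%:R cOm Om1 cf c0.
have -> : integ Om nu (fun=> 0) = 0 by rewrite /integ integral0.
rewrite subr0 => H; apply: le_trans (ler_norm _) _.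
by apply: H => x Ox; rewrite subr0 HN.
Qed.

Definition low_complexity_stable Om d (phi : 'I_d -> seqsp A -> rat) (h : 'rV[R]_d) n :
  set (seqsp A -> R) := [set f | cont_on Om f /\ exists2 r : R, 0 < r &
    forall g, cont_on Om g -> supdist Om f g < r ->
    forall mu, rel_max Om phi h g mu -> low_complexity n mu].

Lemma low_complexity_stable_open Om d (phi : 'I_d -> seqsp A -> rat) h n :
  prod_closed Om -> C_open Om (low_complexity_stable Om phi h n).
Proof.
move=> cOm; split=> [f []//|f [cf [r r0 H]]].
exists (r / 2); first by rewrite divr_gt0.
move=> g cg fg; split=> //; exists (r / 2); first by rewrite divr_gt0.
move=> g' cg' gg'; apply: H => //.
by apply: le_lt_trans (supdist_triangle cOm cf cg cg') _; lra.
Qed.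

(* A continuous function is perturbed into a locally constant one with a penalty
   [c] off the periodic orbits of [periodic_replica]; a relative maximizing
   measure of a nearby function then cannot beat its own periodic replica, so it
   gives little mass to the penalized set. *)
Lemma low_complexity_stable_dense Om d (phi : 'I_d -> seqsp A -> rat) h n :
  subshift Om -> sofic Om -> (forall i, loc_const Om (phi i)) ->
  C_dense Om (low_complexity_stable Om phi h n).
Proof.
move=> sOm soOm lphi; have [cOm _] := sOm; split=> [f []//|f cf e e0].
have [kphi Hphi] := choice lphi.
pose c := e / 4; have c0 : 0 < c by rewrite divr_gt0.
have [kf Hf] := cont_on_unif cOm cf c0.
pose k := maxn kf (\max_i (kphi i).+1).
pose fk x := f (rep a0 Om (word k x)).
have wordE l x y : cyl x l y -> word l x = word l y.
  by move=> xy; apply/ffunP => j; rewrite !ffunE xy.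
have kfk : kdet Om k fk by move=> x y _ _ /wordE xy; rewrite /fk xy.
have ffk x : Om x -> `|f x - fk x| <= c.
  move=> Ox; have wx : wcyl (word k x) x by apply/wcylE.
  have [Or wr] := repP a0 Ox wx; apply/ltW/Hf => //.
  by apply: cyl_le (wcyl_cyl wx wr); exact: leq_maxl.
have kphi' i : kdet Om k (fun x => ratr (phi i x) : R).
  move=> x y Ox Oy xy; rewrite (Hphi i x y) //; apply: cyl_le xy.
  by apply: leq_trans (leq_maxr _ _); exact: (leq_bigmax i).
have [q Hq] := periodic_replica a0 R k sOm soOm.
pose M : R := #|{ffun 'I_q.+1 -> A}|%:R.
pose N := Num.truncn (ln (2 * M) * n.+1%:R).
pose W := [set word N.+1 (per w) | w : {ffun 'I_q.+1 -> A} in [pred w | `[< Om (per w) >]]]%SET.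
pose V : set X := [set x | word N.+1 x \notin W].
have mV : measurable V by apply: (@det_measurable A a0 N.+1) => x y /wordE; rewrite /V /= => ->.
have kV : kdet Om N.+1 (\1_V : seqsp A -> R).
  move=> x y _ _ /wordE xy; rewrite !indicE.
  suff -> : (x \in V) = (y \in V) by [].
  by apply/idP/idP => /set_mem; rewrite /V /= => v; apply/mem_set; move: v; rewrite /= xy.
pose g x := fk x - c * \1_V x.
pose k' := maxn k N.+1.
have kfk' : kdet Om k' fk by apply: kdet_le kfk; exact: leq_maxl.
have kV' : kdet Om k' (\1_V : seqsp A -> R) by apply: kdet_le kV; exact: leq_maxr.
have cg : cont_on Om g.
  apply: (@kdet_cont A R Om k') => x y Ox Oy xy.
  by rewrite /g (kfk' x y) // (kV' x y).
exists g; last first.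
  apply: (@le_lt_trans _ _ (e / 2)); last by lra.
  apply: supdist_le => [|x Ox]; first by rewrite divr_ge0 // ltW.
  have i0 : 0 <= \1_V x :> R by [].
  have i1 : \1_V x <= 1 :> R by rewrite indicE; case: (_ \in _).
  have := ffk x Ox; rewrite /g; move: (\1_V x) i0 i1 => v v0 v1.
  have cv : c * v <= c by rewrite ler_piMr // ltW.
  have cv0 : 0 <= c * v by rewrite mulr_ge0 // ltW.
  have -> : e / 2 = c + c by rewrite /c; lra.
  rewrite !ler_norml => /andP[h1 h2]; move: (c * v) cv cv0 => cv cv1 cv0.
  by apply/andP; split; clear -h1 h2 cv1 cv0; lra.
have n0 : 0 < n.+1%:R :> R by [].
split=> //; exists (c / (2 * n.+1%:R)); first by rewrite divr_gt0 // mulr_gt0.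
set r := c / _ => g' cg' gg' nu [inu [rvnu bnu]].
have [mu [imu emu fmu]] := Hq nu inu.
have [Omu _] := imu; have [Onu _] := inu.
have bmu : integ Om mu g' <= integ Om nu g'.
  rewrite bnu; apply: integ_le_beta => //.
  by rewrite -rvnu; apply/rowP => i; rewrite !mxE emu.
have muV : mu (~` V) = 1%E.
  apply: fmu; first exact: measurableC.
  move=> z Oz /periodic_perE zE; apply/negP; rewrite negbK.
  apply/imsetP; exists [ffun i : 'I_q.+1 => z i]; last by rewrite -zE.
  by rewrite inE /= -zE.
have prV0 : pr mu V = 0.
  have := probability_setC mu (measurableC mV); rewrite setCK muV subee // /pr => ->.
  by [].
have gdist x : Om x -> `|g x - g' x| <= r.
  by move=> Ox; apply: le_trans (ltW gg'); exact: supdist_ub.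
have d1 := integ_dist_le cOm Omu cg cg' gdist.
have d2 := integ_dist_le cOm Onu cg cg' gdist.
have pV : c * pr nu V <= c / n.+1%:R.
  have h1 : integ Om mu g = integ Om mu fk - c * integ Om mu (\1_V : seqsp A -> R).
    exact: integ_kdetB kfk' kV'.
  have h2 : integ Om nu g = integ Om nu fk - c * integ Om nu (\1_V : seqsp A -> R).
    exact: integ_kdetB kfk' kV'.
  rewrite !integ_indic // in h1 h2; rewrite prV0 (emu _ kfk) mulr0 subr0 in h1.
  have -> : c / n.+1%:R = r + r by rewrite /r; field; rewrite addrC natr1 lt0r_neq0.
  move: d1 d2; rewrite h1 h2 !ler_norml => /andP[? ?] /andP[? ?]; lra.
exists N, W; split.
- rewrite lt0n; apply/negP => /eqP/cards0_eq W0.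
  suff : pr mu V = 1 by rewrite prV0 => /esym/eqP; rewrite oner_eq0.
  rewrite -(prT mu); congr (pr mu _); apply/seteqP; split=> // x _.
  by rewrite /V /= W0 inE.
- have WM : #|W|%:R <= M by rewrite ler_nat; apply: leq_trans (leq_imset_card _ _) (max_card _).
  have [->|W0] := eqVneq #|W| 0%N; first by rewrite mulr0 ln0 // divr_ge0.
  have W1 : 0 < #|W|%:R :> R by rewrite ltr0n lt0n.
  apply: (@le_trans _ _ (ln (2 * M))).
    by rewrite ler_ln ?posrE ?mulr_gt0 //; [rewrite ler_wpM2l|exact: lt_le_trans WM].
  by rewrite ler_pdivlMr // ltW // truncnS_gt.
- by move: pV; rewrite ler_pM2l.
Qed.

End Generic.

Theorem theoremB (A : finType) (a0 : A) (R : realType) (Om : set (seqsp A))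
  (d : nat) (phi : 'I_d -> seqsp A -> rat) (h : 'I_d -> rat) :
  subshift Om -> irreducible Om -> sofic Om ->
  (forall i, loc_const Om (phi i)) ->
  interior (@Rot A a0 R Om d phi) (\row_i (ratr (h i) : R)) ->
  exists S : set (seqsp A -> R), C_residual Om S /\
    forall f, S f -> forall mu, @rel_max A a0 R Om d phi (\row_i ratr (h i)) f mu ->
      ks_entropy mu = 0%E.
Proof.
move=> sOm _ soOm lphi _; have [cOm _] := sOm.
pose U n := @low_complexity_stable A a0 R Om d phi (\row_i ratr (h i)) n.
have oU n : C_open Om (U n) by exact: low_complexity_stable_open.
exists (\bigcap_n U n); split.
  split; first by exists U.
  by apply: C_dense_bigcap => // n; exact: low_complexity_stable_dense.
move=> f Uf mu mmu; have [imu _] := mmu.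
apply: (ks_entropy_eq0 imu) => n; have [cf [r r0 H]] := Uf n I.
apply: (H f) => //; apply: le_lt_trans r0; apply: supdist_le => // x _.
by rewrite subrr normr0.
Qed.
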